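(* Let $K$ be a field, let $S=K[t_1,\ldots,t_s]$ with the standard grading, let $\prec$ be a graded monomial order on $S$, let $I\subset S$ be a nonzero complete intersection monomial ideal with $\dim(S/I)\geq 1$ minimally generated by monomials $t^{\alpha_1},\ldots,t^{\alpha_r}$, and let $d\geq 1$ be an integer. If $d_i=\deg(t^{\alpha_i})$ for $i=1,\ldots,r$ and $d_1\leq\cdots\leq d_r$, then $$\delta_I(d)={\rm fp}_I(d)=\begin{cases}(d_{k+1}-\ell)\,d_{k+2}\cdots d_r&\text{if } d<\sum_{i=1}^{r}(d_i-1),\\ 1&\text{if } d\geq\sum_{i=1}^{r}(d_i-1),\end{cases}$$ where, in the first case, $0\leq k\leq r-1$ and $\ell$ are integers such that $d=\sum_{i=1}^{k}(d_i-1)+\ell$ and $1\leq\ell\leq d_{k+1}-1$ (and $d_{k+2}\cdots d_r=1$ if $k=r-1$).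
   Context: For $a=(a_1,\ldots,a_s)\in\mathbb{N}^s$, $t^a=t_1^{a_1}\cdots t_s^{a_s}$. An ideal $I$ is a complete intersection if it can be generated by ${\rm ht}(I)$ elements. A graded monomial order is one that first compares monomials by total degree. $S=\bigoplus_{d\ge 0}S_d$ is the standard graded polynomial ring and $\mathbb{N}_+$ is the set of positive integers. For a proper graded ideal $J$ of $S$ with $k=\dim(S/J)$ (Krull dimension) and Hilbert function $H_J(d)=\dim_K(S_d/J_d)$, the degree (multiplicity) is $\deg(S/J)=(k-1)!\lim_{d\to\infty}H_J(d)/d^{k-1}$ if $k\geq 1$ and $\deg(S/J)=\dim_K(S/J)$ if $k=0$. $(J\colon f)=\{h\in S: hf\in J\}$. For $d\geq 1$, let $\mathcal{F}_d=\{f\in S_d: f\notin I,\ (I\colon f)\neq I\}$. The minimum distance function $\delta_I\colon\mathbb{N}_+\to\mathbb{Z}$ of $I$ is $\delta_I(d)=\deg(S/I)-\max\{\deg(S/(I,f)): f\in\mathcal{F}_d\}$ if $\mathcal{F}_d\neq\emptyset$, and $\delta_I(d)=\deg(S/I)$ if $\mathcal{F}_d=\emptyset$. ${\rm in}_\prec(I)$ is the initial ideal of $I$. Let $\mathcal{M}_{\prec,d}$ be the set of monomials $t^a\in S_d$ with $t^a\notin{\rm in}_\prec(I)$ and $({\rm in}_\prec(I)\colon t^a)\neq{\rm in}_\prec(I)$. The footprint function ${\rm fp}_I\colon\mathbb{N}_+\to\mathbb{Z}$ of $I$ (with respect to $\prec$) is ${\rm fp}_I(d)=\deg(S/I)-\max\{\deg(S/({\rm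 in}_\prec(I),t^a)): t^a\in\mathcal{M}_{\prec,d}\}$ if $\mathcal{M}_{\prec,d}\neq\emptyset$, and ${\rm fp}_I(d)=\deg(S/I)$ if $\mathcal{M}_{\prec,d}=\emptyset$. *)

(* Defs.v *)
From HB Require Import structures.
From mathcomp Require Import all_boot all_order all_algebra.
(* mpoly has to be imported before topology and normedtype: the opposite order
   fails on incompatible notation levels. *)
From mathcomp.multinomials Require Import mpoly.
From mathcomp Require Import ring_quotient boolp classical_sets.
From mathcomp Require Import filter topology normedtype.

Set Implicit Arguments.
Unset Strict Implicit.
Unset Printing Implicit Defensive.

Import Order.TTheory GRing.Theory Num.Theory.
Import numFieldNormedType.Exports.

Local Open Scope classical_set_scope.
Local Open Scope ring_scope.

(* The value is x0 when A has no greatest (resp. least) element. *)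
Definition set_max (disp : Order.disp_t) (T : porderType disp) (x0 : T)
  (A : set T) : T := xget x0 (A `&` ubound A).

Definition set_min (disp : Order.disp_t) (T : porderType disp) (x0 : T)
  (A : set T) : T := xget x0 (A `&` lbound A).

Section Ideals.
Variables (K : fieldType) (n : nat).
Local Notation S := {mpoly K[n]}.
Implicit Types (A I J P V W : set S) (f : S).

Definition ideal_gen A : set S :=
  [set p | exists (m : nat) (c g : 'I_m -> S),
             (forall i, A (g i)) /\ p = \sum_(i < m) c i * g i].

Definition colon J f : set S := [set h | J (h * f)].

(* [idealr_closed] includes that 1 is not in P. *)
Definition prime_ideal P : Prop :=
  idealr_closed (mem P) /\ prime_idealr_closed (mem P).

Definition prime_chain (k : nat) (C : nat -> set S) : Prop :=
  (forall i, (i <= k)%N -> prime_ideal (C i)) /\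
  (forall i, (i < k)%N -> C i `<` C i.+1).

(* dim(S/J): the primes of S/J are those of S that contain J. *)
Definition quot_krull_dim J : nat :=
  set_max 0%N [set k | exists C, prime_chain k C /\ J `<=` C 0%N].

Definition prime_height P : nat :=
  set_max 0%N [set k | exists C, prime_chain k C /\ C k = P].

Definition height I : nat :=
  set_min 0%N (prime_height @` [set P | prime_ideal P /\ I `<=` P]).

Definition complete_intersection I : Prop :=
  exists g : 'I_(height I) -> S, I = ideal_gen (range g).

Definition minimal_generators (r : nat) (g : 'I_r -> S) I : Prop :=
  I = ideal_gen (range g) /\
  forall B : {set 'I_r}, B \proper [set: 'I_r]%SET ->
    I <> ideal_gen [set g i | i in [set` B]].

Definition homog_part (d : nat) : set S := [set p | p \is d.-homog].

(* dim_K(V/W) for K-subspaces W of V: the size of a family of V whose classes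
   form a basis of V/W; 0 if V/W is infinite-dimensional. *)
Definition quot_dim V W : nat :=
  xget 0%N [set m | exists b : 'I_m -> S,
    (forall i, V (b i)) /\
    (forall v, V v -> exists! c : {ffun 'I_m -> K},
       W (v - \sum_(i < m) c i *: b i))].

Definition hilbert_function J (d : nat) : nat :=
  quot_dim (homog_part d) (J `&` homog_part d).

(* deg(S/J) is an integer, so the limit may be taken among the rationals. *)
Definition quot_degree J : int :=
  let k := quot_krull_dim J in
  if k == 0%N then (quot_dim setT J)%:Z else
  xget 0 [set e : int |
    (fun d : nat => (k.-1)`!%:R * ((hilbert_function J d)%:R / d%:R ^+ k.-1)
       : rat^o) @ \oo --> (e%:~R : rat^o)].

Definition zero_divisors_in_degree I (d : nat) : set S :=
  [set f | homog_part d f /\ ~ I f /\ colon I f <> I].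

Definition min_distance I (d : nat) : int :=
  let F := zero_divisors_in_degree I d in
  if F == set0 then quot_degree I else
  quot_degree I -
    set_max 0 [set quot_degree (ideal_gen (I `|` [set f])) | f in F].

(* Monomial orders are given by their non-strict relation. *)
Definition graded_monomial_order (le : rel 'X_{1..n}) : Prop :=
  [/\ reflexive le, antisymmetric le, transitive le & total le] /\
  [/\ forall m, le 0%MM m,
      forall m m1 m2, le m1 m2 -> le (m + m1)%MM (m + m2)%MM
    & forall m1 m2, (mdeg m1 < mdeg m2)%N -> le m1 m2].

Definition is_leading_monomial (le : rel 'X_{1..n}) f (m : 'X_{1..n}) : Prop :=
  m \in msupp f /\ forall m', m' \in msupp f -> le m' m.

Definition initial_ideal (le : rel 'X_{1..n}) I : set S :=
  ideal_gen [set 'X_[m] | m in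
    [set m | exists2 f, I f & is_leading_monomial le f m]].

Definition footprint_monomials (le : rel 'X_{1..n}) I (d : nat) :
    set 'X_{1..n} :=
  let L := initial_ideal le I in
  [set a | mdeg a = d /\ ~ L 'X_[a] /\ colon L 'X_[a] <> L].

Definition footprint (le : rel 'X_{1..n}) I (d : nat) : int :=
  let L := initial_ideal le I in
  let M := footprint_monomials le I d in
  if M == set0 then quot_degree I else
  quot_degree I -
    set_max 0 [set quot_degree (ideal_gen (L `|` [set 'X_[a]])) | a in M].

End Ideals.

(* Main.v *)
Require Import Defs.
From HB Require Import structures.
From mathcomp Require Import all_boot all_order all_algebra.
From mathcomp.multinomials Require Import mpoly.
From mathcomp Require Import ring_quotient boolp classical_sets.
From mathcomp Require Import filter topology normedtype.
From mathcomp Require Import zify ring lra.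

(** Why the theorem holds.

    Write the generators as t^alpha_1, ..., t^alpha_r, with degrees d_i, in a
    ring in s variables.  A generating set of I has at least r elements
    (compare coefficients at the monomials alpha_i, which form an antichain),
    while the height of I is at most the number of variables in any set that
    meets the support of every alpha_i.  If two supports met, fewer than r
    variables would do; so for a complete intersection the supports are
    pairwise disjoint ([complete_intersection_disjoint]).

    With disjoint supports everything can be computed.  Adding generators one
    at a time gives H_{r}(e) = H_{r-1}(e) - H_{r-1}(e - d_r) for the number of
    monomials of degree e outside the ideal, so this number is eventually a
    polynomial of degree s - r - 1 and the degree of S/I is the product of the
    d_i ([ev_poly_std_count], [degree_monI]).  For a monomial t^a the colon
    ideal (I : t^a) is generated by the t^(alpha_i - a), with truncated
    subtraction, again with disjoint supports; hence
      deg S/I - deg S/(I, t^a) = prod_i |alpha_i - a|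
    as soon as t^a is a zero divisor modulo I ([degree_add_candidate]).

    A homogeneous zero divisor f lies in an associated prime of I.  These are
    generated by variables, one from each support, so every monomial of f
    is a zero divisor too.  Remove from f its monomials in I and let t^a be the
    leading monomial of the rest: the monomials outside (I, t^a) still span
    S/(I, f), so deg S/(I, f) <= deg S/(I, t^a) ([degree_add_le]).  Together
    with in(I) = I this shows that the minimum distance and the footprint are
    both the minimum of prod_i |alpha_i - a| over the monomial zero divisors
    of degree d outside I ([distances_candidate]).

    What is left is arithmetic: lower numbers d_i by a total of at most d,
    keeping each at least 1, so as to minimise their product.  The greedy
    choice, exhausting the small d_i first, is optimal ([greedy_min]), and a
    product of submonomials of the t^alpha_i realises it.

    The degree depends on the Krull dimension, which must equal s - r for all
    the ideals above.  A chain of k + 1 primes yields, for each M, M^k elements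
    of degree O(M) that are linearly independent modulo its least member
    ([prime_chain_free]); if that member contains c variables, at most
    O(M^(s - c)) monomials remain, so k <= s - c ([prime_chain_le]). *)

Set Implicit Arguments.
Unset Strict Implicit.
Unset Printing Implicit Defensive.

Import Order.TTheory GRing.Theory Num.Theory.
Import numFieldNormedType.Exports.

Local Open Scope classical_set_scope.
Local Open Scope ring_scope.

(** * Linear algebra modulo a subspace *)

Section LinearAlgebra.
Variables (K : fieldType) (V : lmodType K).
Implicit Types (W : set V).

Definition is_subspace W : Prop :=
  W 0 /\ forall a u v, W u -> W v -> W (a *: u + v).

Lemma subspace_sum W (T : finType) (c : T -> K) (w : T -> V) :
  is_subspace W -> (forall t, W (w t)) -> W (\sum_t c t *: w t).
Proof.
move=> [W0 WD] Ww; apply: big_ind => // [u v Wu Wv|t _].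
  by rewrite -[u]scale1r; apply: WD.
by rewrite -[_ *: _]addr0; apply: WD.
Qed.

Definition free_mod W (T : finType) (b : T -> V) : Prop :=
  forall c : T -> K, W (\sum_t c t *: b t) -> forall t, c t = 0.

(** Steinitz bound: write the b t in terms of the g j modulo W. With more rows
    than columns the coefficient matrix has a nonzero vector in its left kernel,
    which is a relation between the b t modulo W. *)
Lemma free_mod_le_span W (T : finType) (b : T -> V) (N : nat) (g : 'I_N -> V) :
  is_subspace W -> free_mod W b ->
  (forall t, exists c : 'I_N -> K, W (b t - \sum_j c j *: g j)) ->
  (#|T| <= N)%N.
Proof.
move=> subW freeb /choice[c hc]; rewrite leqNgt; apply/negP=> ltN.
pose A := \matrix_(i < #|T|, j < N) c (enum_val i) j.
have: ~~ row_free A.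
  by rewrite -row_leq_rank -ltnNge; apply: leq_ltn_trans (rank_leq_col A) ltN.
rewrite -kermx_eq0 => /rowV0Pn[v /sub_kermxP vA v0].
case/rV0Pn: v0 => i; apply/negP; rewrite negbK; apply/eqP.
pose d t := v 0 (enum_rank t).
suff /freeb/(_ (enum_val i)) : W (\sum_t d t *: b t).
  by rewrite /d enum_valK.
have -> : \sum_t d t *: b t = \sum_t d t *: (b t - \sum_j c t j *: g j).
  under [RHS]eq_bigr do rewrite scalerBr scaler_sumr.
  rewrite sumrB [X in _ - X]exchange_big [X in _ - X]big1 ?subr0 //= => j _.
  under eq_bigr do rewrite scalerA.
  rewrite -scaler_suml; suff -> : \sum_t d t * c t j = 0 by rewrite scale0r.
  move/matrixP/(_ 0 j): vA; rewrite !mxE => {2}<-.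
  rewrite (reindex_onto (@enum_val T predT) enum_rank) /=; last first.
    by move=> t _; rewrite enum_rankK.
  apply: eq_big => [k|k _]; first by rewrite enum_valK eqxx.
  by rewrite mxE /d enum_valK.
exact: subspace_sum.
Qed.

End LinearAlgebra.

Section QuotDim.
Variables (K : fieldType) (n : nat).
Local Notation S := {mpoly K[n]}.

Definition quot_basis (V W : set S) m (b : 'I_m -> S) : Prop :=
  (forall i, V (b i)) /\
    (forall v, V v -> exists! c : {ffun 'I_m -> K},
       W (v - \sum_(i < m) c i *: b i)).

(** Uniqueness of the coordinates of 0. *)
Lemma quot_basis_free (V W : set S) m (b : 'I_m -> S) :
  is_subspace V -> is_subspace W -> quot_basis V W b -> free_mod W b.
Proof.
move=> [V0 _] subW [_ hb] c Wc i.
have [e [_ eu]] := hb 0 V0.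
have e0 : e = [ffun=> 0].
  apply: eu; rewrite big1 ?subr0; first by case: subW.
  by move=> j _; rewrite ffunE scale0r.
have : e = [ffun j => - c j].
  apply: eu; rewrite sub0r -sumrN.
  under eq_bigr do rewrite ffunE scaleNr opprK.
  exact: Wc.
rewrite e0 => /ffunP/(_ i); rewrite !ffunE => /eqP.
by rewrite eq_sym oppr_eq0 => /eqP.
Qed.

Lemma quot_basis_span (V W : set S) m (b : 'I_m -> S) v :
  quot_basis V W b -> V v -> exists c : 'I_m -> K, W (v - \sum_i c i *: b i).
Proof. by move=> [_ hb] /hb[c [Wc _]]; exists c. Qed.

(** The bound also holds when V/W has no finite basis: quot_dim is then 0. *)
Lemma quot_dim_le (V W : set S) (N : nat) (g : 'I_N -> S) :
  is_subspace V -> is_subspace W ->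
  (forall v, V v -> exists c : 'I_N -> K, W (v - \sum_j c j *: g j)) ->
  (quot_dim V W <= N)%N.
Proof.
move=> sV sW spang; rewrite /quot_dim; case: xgetP => [m _ [b hb]|//].
rewrite -(card_ord m); apply: (@free_mod_le_span _ _ W _ b _ g) => //.
  exact: quot_basis_free hb.
by move=> i; apply: spang; case: hb.
Qed.

Lemma quot_dim_basis (V W : set S) m (b : 'I_m -> S) :
  is_subspace V -> is_subspace W -> quot_basis V W b -> quot_dim V W = m.
Proof.
move=> sV sW hb; apply/eqP; rewrite eqn_leq; apply/andP; split.
  by apply: (quot_dim_le (g := b)) => // v; apply: quot_basis_span.
rewrite /quot_dim; case: xgetP => [m' _ [b' hb']|/(_ m) []]; last by exists b.
rewrite -[X in (X <= _)%N](card_ord m).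
apply: (@free_mod_le_span _ _ W _ b _ b') => //.
  exact: quot_basis_free hb.
by move=> i; apply: quot_basis_span hb' _; case: hb.
Qed.

Lemma quot_basisP (V W : set S) m (b : 'I_m -> S) :
  is_subspace W -> (forall i, V (b i)) -> free_mod W b ->
  (forall v, V v -> exists c : 'I_m -> K, W (v - \sum_j c j *: b j)) ->
  quot_basis V W b.
Proof.
move=> sW Vb fb sb; split=> // v /sb[c Wc]; exists (finfun c); split.
  by under eq_bigr do rewrite ffunE.
move=> c' Wc'; apply/ffunP => i; rewrite ffunE; apply/eqP.
rewrite -subr_eq0; apply/eqP; move: i; apply: fb.
under eq_bigr do rewrite scalerBl.
rewrite sumrB; have [_ /(_ (-1) _ _ Wc Wc')] := sW.
by rewrite scaleN1r opprB addrA subrK.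
Qed.

End QuotDim.

(** * Monomial ideals *)

Lemma seq_has_max (T : eqType) (le : rel T) (xs : seq T) :
  total le -> transitive le -> xs != [::] ->
  exists2 x, x \in xs & forall y, y \in xs -> le y x.
Proof.
move=> tot tr; elim: xs => // x xs IH _.
have [->|/IH[y yxs hy]] := eqVneq xs [::].
  exists x; rewrite ?mem_head // => y; rewrite inE => /eqP ->.
  by have := tot x x; rewrite orbb.
have /orP[xy|yx] := tot x y; [exists y|exists x]; rewrite ?inE ?eqxx ?yxs ?orbT //.
  by move=> z; rewrite inE => /predU1P[->//|/hy].
move=> z; rewrite inE => /predU1P[->|/hy zy]; last exact: tr zy yx.
by have := tot x x; rewrite orbb.
Qed.

Section MonomialIdeals.
Variables (K : fieldType) (n : nat).
Local Notation S := {mpoly K[n]}.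
Implicit Types (f h p q : S) (m : 'X_{1..n}) (A : pred 'X_{1..n}).
Implicit Types (C : {set 'I_n}).

Definition is_ideal (J : set S) : Prop :=
  J 0 /\ forall a u v, J u -> J v -> J (a * u + v).

Lemma ideal_subspace J : is_ideal J -> is_subspace J.
Proof.
by move=> [J0 JD]; split=> // a u v Ju Jv; rewrite -mul_mpolyC; apply: JD.
Qed.

Lemma idealM J a u : is_ideal J -> J u -> J (a * u).
Proof. by move=> [J0 JD] Ju; rewrite -[_ * _]addr0; apply: JD. Qed.

Lemma idealD J u v : is_ideal J -> J u -> J v -> J (u + v).
Proof. by move=> [J0 JD] Ju Jv; rewrite -[u]mul1r; apply: JD. Qed.

Lemma idealB J u v : is_ideal J -> J u -> J v -> J (u - v).
Proof. by move=> [J0 JD] Ju Jv; rewrite addrC -mulN1r; apply: JD. Qed.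

Lemma ideal_sum J (T : finType) (F : T -> S) :
  is_ideal J -> (forall t, J (F t)) -> J (\sum_t F t).
Proof.
by move=> idJ JF; apply: big_ind => //; [case: idJ|move=> ? ?; apply: idealD].
Qed.

Lemma sub_ideal_gen (A : set S) : A `<=` ideal_gen A.
Proof.
move=> f Af; exists 1%N, (fun=> 1), (fun=> f); split=> //.
by rewrite big_ord1 mul1r.
Qed.

Lemma ideal_gen_sub (A J : set S) : is_ideal J -> A `<=` J -> ideal_gen A `<=` J.
Proof.
move=> idJ AJ _ [m [c [g [Ag ->]]]]; apply: ideal_sum => // i.
by apply: idealM => //; apply: AJ.
Qed.

Lemma ideal_gen_ideal (A : set S) : is_ideal (ideal_gen A).
Proof.
split; first by exists 0%N, (fun=> 0), (fun=> 0); split=> [[]//|]; rewrite big_ord0.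
move=> a _ _ [m1 [c1 [g1 [A1 ->]]]] [m2 [c2 [g2 [A2 ->]]]].
pose glue T (u1 : 'I_m1 -> T) (u2 : 'I_m2 -> T) i :=
  match split i with inl j => u1 j | inr j => u2 j end.
exists (m1 + m2)%N, (glue _ (fun j => a * c1 j) c2), (glue _ g1 g2).
split; first by move=> i; rewrite /glue; case: split.
rewrite big_split_ord /= mulr_sumr; congr (_ + _); apply: eq_bigr => i _.
  by rewrite /glue (unsplitK (inl i)) mulrA.
by rewrite /glue (unsplitK (inr i)).
Qed.

Definition up_closed A : Prop := forall m m', A m -> (m <= m')%MM -> A m'.

Definition mon_ideal A : set S := [set f | forall m, m \in msupp f -> A m].

Lemma mon_idealX A m : mon_ideal A 'X_[m] <-> A m.
Proof.
split; first by apply; rewrite msuppX mem_head.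
by move=> Am m'; rewrite msuppX inE => /eqP ->.
Qed.

Lemma mon_ideal_ideal A : up_closed A -> is_ideal (mon_ideal A).
Proof.
move=> upA; split=> [m|a u v Au Av m]; first by rewrite msupp0.
move/msuppD_le; rewrite mem_cat => /orP[|/Av//].
move=> /msuppM_le/allpairsP[[m1 m2] /= [_ /Au Am ->]].
by apply: upA Am _; apply: lem_addl.
Qed.

Lemma mon_ideal_span A (J : set S) f : is_ideal J ->
  (forall m, A m -> J 'X_[m]) -> mon_ideal A f -> J f.
Proof.
move=> idJ AJ Af; rewrite [f]mpolyE big_seq.
apply: big_ind => [|u v|m /Af/AJ]; [by case: idJ|exact: idealD|].
by rewrite -mul_mpolyC; apply: idealM.
Qed.

Lemma ideal_gen_monomials (G : set 'X_{1..n}) A : up_closed A ->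
  (forall m, A m <-> exists2 g, G g & (g <= m)%MM) ->
  ideal_gen [set 'X_[m] | m in G] = mon_ideal A.
Proof.
move=> upA AG; apply/seteqP; split.
  apply: ideal_gen_sub; first exact: mon_ideal_ideal.
  by move=> _ [g Gg <-]; apply/mon_idealX/AG; exists g => //; apply: lepm_refl.
move=> f; apply: mon_ideal_span; first exact: ideal_gen_ideal.
move=> m /AG[g Gg gm]; rewrite -(submK gm) mpolyXD.
apply: idealM; first exact: ideal_gen_ideal.
by apply: sub_ideal_gen; exists g.
Qed.

(** A monomial ideal contains every monomial of each of its elements, in
    particular the leading one, so it is its own initial ideal. *)
Lemma initial_mon_ideal le A : reflexive le -> up_closed A ->
  initial_ideal le (mon_ideal A) = mon_ideal A.
Proof.
move=> refl_le upA; apply: ideal_gen_monomials => // m; split.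
  move=> Am; exists m; last exact: lepm_refl.
  exists 'X_[m]; first exact/mon_idealX.
  by split=> [|m']; rewrite msuppX inE // => /eqP->.
by move=> [g [f Af [/Af Ag _]]]; apply: upA.
Qed.

(** No cancellation in a product at a monomial that splits in one way only. *)
Lemma mcoeffM_unique p q mp mq :
  (forall k1 k2, k1 \in msupp p -> k2 \in msupp q ->
     (k1 + k2 = mp + mq)%MM -> k1 = mp /\ k2 = mq) ->
  (p * q)@_(mp + mq) = p@_mp * q@_mq.
Proof.
move=> huniq; rewrite mcoeffM.
have bp : (mdeg mp < (mdeg (mp + mq)%MM).+1)%N by rewrite mdegD ltnS leq_addr.
have bq : (mdeg mq < (mdeg (mp + mq)%MM).+1)%N by rewrite mdegD ltnS leq_addl.
rewrite (bigD1 (BMultinom bp, BMultinom bq)) //= big1 ?addr0 // => -[k1 k2] /=.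
move=> /andP[/eqP km neqk].
have [k1p|/memN_msupp_eq0 ->] := boolP (val k1 \in msupp p); last by rewrite mul0r.
have [k2q|/memN_msupp_eq0 ->] := boolP (val k2 \in msupp q); last by rewrite mulr0.
have [e1 e2] := huniq _ _ k1p k2q (esym km).
by case/eqP: neqk; congr pair; apply: val_inj.
Qed.

Definition weight (C : {set 'I_n}) m : nat := (\sum_(v in C) m v)%N.

Lemma weightD C m m' : weight C (m + m')%MM = (weight C m + weight C m')%N.
Proof. by rewrite /weight -big_split; apply: eq_bigr => v _; rewrite mnmDE. Qed.

Lemma weight_neq0P C m :
  reflect (exists2 v, v \in C & m v != 0%N) (weight C m != 0%N).
Proof.
apply: (iffP idP); rewrite /weight sum_nat_eq0 => H.
  move/forallPn: H => [v]; rewrite negb_imply => /andP[vC mv]; by exists v.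
by apply/forallPn; case: H => v vC mv; exists v; rewrite vC.
Qed.

Lemma weight_up C : up_closed (fun m => weight C m != 0%N).
Proof.
move=> m m' /weight_neq0P[v vC mv] /mnm_lepP/(_ v) mm'.
by apply/weight_neq0P; exists v => //; rewrite -lt0n (leq_trans _ mm') // lt0n.
Qed.

(** The prime ideal generated by the variables in C, in terms of monomials. *)
Definition var_ideal C : set S := mon_ideal (fun m => weight C m != 0%N).

Lemma var_ideal_ideal C : is_ideal (var_ideal C).
Proof. exact/mon_ideal_ideal/weight_up. Qed.

(** If membership in the ideal of A depends only on the exponents of the
    variables in C, that ideal is primary to the prime generated by these
    variables. Order monomials by decreasing weight in C, ties being broken by
    any monomial order. The largest monomial of h outside A and the largest
    monomial of f, which has weight 0, multiply to a monomial of h * f that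
    arises in no other way and lies outside A. *)
Lemma mon_ideal_primary C A h f : up_closed A ->
  (forall m m', A (m + m')%MM -> weight C m' = 0%N -> A m) ->
  ~ mon_ideal A h -> ~ var_ideal C f -> ~ mon_ideal A (h * f).
Proof.
move=> upA AC nh nf hhf.
pose lew m1 m2 := (weight C m2 < weight C m1)%N ||
  (weight C m1 == weight C m2) && (m1 <= m2)%O.
have lew_tot : total lew.
  move=> x y; rewrite /lew; case: ltngtP => //= _.
  exact: le_total.
have lew_tr : transitive lew.
  move=> y x z; rewrite /lew => /orP[xy|/andP[/eqP -> xy]].
    by move=> /orP[yz|/andP[/eqP <- _]]; rewrite ?xy // (ltn_trans yz xy).
  by move=> /orP[->//|/andP[-> yz]]; rewrite (le_trans xy yz) orbT.
have key B p : ~ mon_ideal B p ->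
    exists m, [/\ m \in msupp p, ~~ B m &
      forall m', m' \in msupp p -> ~~ B m' -> lew m' m].
  move=> nBp; case: (@seq_has_max _ lew [seq m <- msupp p | ~~ B m]) => //.
    apply/eqP => H; apply: nBp => m mp; apply: contraT => Bm.
    by have : m \in [::] by rewrite -H mem_filter Bm.
  move=> m; rewrite mem_filter => /andP[Bm mp] hm; exists m; split=> // m' m'p Bm'.
  by apply: hm; rewrite mem_filter Bm'.
have [mh [mhh Amh maxh]] := key _ _ nh.
have [mf [mff]] := key _ _ nf; rewrite negbK => /eqP wmf maxf.
have /hhf /AC/(_ wmf) : (mh + mf)%MM \in msupp (h * f); last by apply/negP.
rewrite mcoeff_msupp mcoeffM_unique ?mulf_neq0 -?mcoeff_msupp //.
move=> k1 k2 k1h k2f ek.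
have nAk1 : ~~ A k1.
  apply/negP => Ak1; case/negP: Amh; apply: AC wmf; rewrite -ek.
  by apply: upA Ak1 _; apply: lem_addr.
have := maxh _ k1h nAk1; have := congr1 (weight C) ek; rewrite !weightD wmf.
rewrite /lew addn0 => ew /orP[|/andP[/eqP ew1 le1]]; first by rewrite -ew; lia.
have wk2 : weight C k2 = 0%N by move: ew; rewrite ew1; lia.
have := maxf _ k2f; rewrite wk2 => /(_ isT).
rewrite /lew wk2 wmf ltnn eqxx /= => le2.
move: le1; rewrite le_eqVlt => /predU1P[e1|lt1].
  by split=> //; move/eqP: ek; rewrite e1 eqm_add2l => /eqP.
by have := ltmc_le_add lt1 le2; rewrite ek ltxx.
Qed.

Lemma var_ideal_prime C : prime_ideal (var_ideal C).
Proof.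
have [P0 PD] := var_ideal_ideal C.
split; last first.
  move=> u v; rewrite !inE => Puv; apply/orP.
  apply: contrapT => /not_orP[/negP nu /negP nv].
  have {}nu : ~ var_ideal C u by move=> h; case/negP: nu; rewrite inE.
  have {}nv : ~ var_ideal C v by move=> h; case/negP: nv; rewrite inE.
  apply: mon_ideal_primary nu nv Puv; first exact: weight_up.
  by move=> m m' /= + w0; rewrite weightD w0 addn0.
split; rewrite ?inE //; last by move=> a u v; rewrite !inE; apply: PD.
apply/negP; rewrite inE => /(_ 0%MM); rewrite msupp1 mem_head => /(_ isT).
by rewrite /weight big1 // => i _; rewrite mnm0E.
Qed.

End MonomialIdeals.

(** * Upper bounds for chains of primes *)

Section KrullDimension.
Variables (K : fieldType) (n : nat).
Local Notation S := {mpoly K[n]}.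
Implicit Types (C : {set 'I_n}) (P : set S) (f : S).

Lemma prime_idealP P : prime_ideal P ->
  [/\ is_ideal P, ~ P 1 & forall u v, P (u * v) -> P u \/ P v].
Proof.
have inP u : (u \in mem P) = `[< P u >] by [].
move=> [[P0 P1 PD] PM]; split.
- split=> [|a u v Pu Pv]; first by apply/asboolP; rewrite -inP.
  by apply/asboolP; rewrite -inP; apply: PD; rewrite inP; apply/asboolP.
- by move=> p1; case/negP: P1; rewrite inP; apply/asboolP.
move=> u v /asboolP; rewrite -inP => /PM.
by rewrite !inP => /orP[]/asboolP; [left|right].
Qed.

(** Multiplying a family that is independent modulo P' by the powers of an f in
    P' but not in P gives a family independent modulo P: modulo P' only the
    terms without f survive, so their coefficients vanish; the rest is divisible
    by f, which cancels because P is prime. *)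
Lemma free_mod_powers P P' f (T : finType) (b : T -> S) M :
  prime_ideal P -> prime_ideal P' -> P `<=` P' -> P' f -> ~ P f ->
  free_mod P' b ->
  free_mod P (fun at_ : 'I_M * T => f ^+ at_.1 * b at_.2).
Proof.
move=> /prime_idealP[idP _ mulP] /prime_idealP[idP' _ _] PP' P'f nPf freeb.
elim: M => [|M IH] c; first by move=> _ [[]].
pose tail := \sum_(at_ : 'I_M * T)
  c (lift ord0 at_.1, at_.2) *: (f ^+ at_.1 * b at_.2).
have -> : \sum_at_ c at_ *: (f ^+ at_.1 * b at_.2) =
    \sum_t c (ord0, t) *: b t + f * tail.
  transitivity (\sum_(a < M.+1) \sum_t c (a, t) *: (f ^+ a * b t)).
    by rewrite pair_bigA; apply: eq_bigr => -[].
  rewrite big_ord_recl; congr (_ + _).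
    by apply: eq_bigr => t _; rewrite expr0 mul1r.
  transitivity (\sum_(a < M) \sum_t f * (c (lift ord0 a, t) *: (f ^+ a * b t))).
    apply: eq_bigr => a _; apply: eq_bigr => t _.
    by rewrite -scalerAr mulrA -exprS.
  by rewrite pair_bigA mulr_sumr.
move=> Psum.
have head0 t : c (ord0, t) = 0.
  apply: (freeb (fun t => c (ord0, t))).
  have P'ft : P' (f * tail) by rewrite mulrC; apply: idealM.
  by rewrite -[X in P' X](addrK (f * tail)); apply: idealB => //; apply: PP'.
move: Psum; rewrite big1 => [|t _]; last by rewrite head0 scale0r.
rewrite add0r => /mulP[//|/IH tail0] [a t].
by case: (unliftP ord0 a) => [a'|] -> //; apply: (tail0 (a', t)).
Qed.

Lemma leq_expn2r a b d : (a <= b)%N -> (a ^ d <= b ^ d)%N.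
Proof. by case: d => // d; rewrite leq_exp2r. Qed.

Lemma msize_mul_le (p q : S) a b :
  (msize p <= a.+1)%N -> (msize q <= b.+1)%N -> (msize (p * q) <= (a + b).+1)%N.
Proof.
move=> pa qb; rewrite msizeE; apply/bigmax_leqP_seq => m + _.
move=> /msuppM_le/allpairsP[[m1 m2] /= [/msize_mdeg_lt m1p /msize_mdeg_lt m2q ->]].
by rewrite mdegD; lia.
Qed.

Lemma msize_exp_le (p : S) a k :
  (msize p <= a.+1)%N -> (msize (p ^+ k) <= (k * a).+1)%N.
Proof.
move=> pa; elim: k => [|k IH]; first by rewrite expr0 msize1.
by rewrite exprS mulSn; apply: msize_mul_le.
Qed.

(** Choose one element per step of the chain, in the larger prime but not in the
    smaller; the products of their powers with exponents below M are
    independent, and of degree linear in M. *)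
Lemma prime_chain_free k (Q : nat -> set S) : prime_chain k Q ->
  exists c : nat, forall M : nat, exists (T : finType) (b : T -> S),
    [/\ #|T| = (M ^ k)%N, free_mod (Q 0%N) b &
        forall t, (msize (b t) <= (M * c).+1)%N].
Proof.
elim: k Q => [|k IH] Q [Qprime Qlt].
  have /prime_idealP[idP nP1 _] := Qprime 0%N isT.
  exists 0%N => M; exists unit, (fun=> 1); split; first by rewrite card_unit.
    move=> a Pa t; apply/eqP; apply: contrapT => /negP a0; apply: nP1.
    have : Q 0%N ((a tt)^-1%:MP * \sum_t a t *: 1) by apply: idealM.
    rewrite (bigD1 tt) //= big1 ?addr0 => [|[]//]; rewrite -mul_mpolyC mulrA -mpolyCM mulr1.
    by case: t a0 => a0; rewrite mulVf.
  by move=> _; rewrite msize1.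
have [|c hc] := IH (fun i => Q i.+1).
  by split=> i ik; [apply: Qprime|apply: Qlt].
have [Q01 /existsNP[f /not_implyP[Q1f nQ0f]]] := Qlt 0%N isT.
exists (c + msize f)%N => M; have [T [b [cT freeb szb]]] := hc M.
exists ('I_M * T)%type, (fun at_ : 'I_M * T => f ^+ at_.1 * b at_.2); split.
- by rewrite card_prod card_ord cT expnS.
- by apply: free_mod_powers Q01 _ nQ0f freeb => //; apply: Qprime.
move=> [a t] /=; apply: leq_trans (msize_mul_le (msize_exp_le _ (leqnSn _)) (szb t)) _.
by rewrite ltnS mulnDr addnC leq_add2l leq_mul2r ltnW ?orbT.
Qed.

Definition off_box C e : pred {ffun 'I_n -> 'I_e.+1} :=
  mem (pffun_on ord0 (~: C) predT).

(** Modulo the variables in C, a polynomial of degree at most e is a combination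
    of the monomials of the box. *)
Lemma free_mod_var_ideal_le C P (T : finType) (b : T -> S) e :
  is_ideal P -> var_ideal C `<=` P -> free_mod P b ->
  (forall t, (msize (b t) <= e.+1)%N) -> (#|T| <= e.+1 ^ (n - #|C|))%N.
Proof.
move=> idP CP freeb szb.
pose B := @off_box C e.
have cB : #|B| = (e.+1 ^ (n - #|C|))%N.
  by rewrite card_pffun_on card_ord [#|~: C|]cardsCs finset.setCK card_ord.
rewrite -cB; pose mon (j : 'I_#|B|) := [multinom (enum_val j v : nat) | v < n].
have mon_inj : injective mon.
  move=> i j /mnmP eij; apply/enum_val_inj/ffunP => v; apply/val_inj.
  by have := eij v; rewrite !mnmE.
apply: (free_mod_le_span (g := fun j => 'X_[mon j])) freeb _.
  exact: ideal_subspace.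
move=> t; exists (fun j => (b t)@_(mon j)); apply: CP => m.
rewrite mcoeff_msupp; apply: contra => wm.
have wm0 v : v \in C -> m v = 0%N.
  move=> vC; apply/eqP; move: wm.
  by rewrite /weight sum_nat_eq0 => /forallP/(_ v); rewrite vC.
have coefsum : (\sum_j (b t)@_(mon j) *: 'X_[mon j])@_m =
    \sum_j (b t)@_(mon j) * (mon j == m)%:R.
  by rewrite raddf_sum; apply: eq_bigr => j _; rewrite /= mcoeffZ mcoeffX.
have [/existsP[j /eqP jm]|noj] := boolP [exists j, mon j == m].
  rewrite mcoeffB coefsum (bigD1 j) //= jm eqxx mulr1 big1 ?addr0 ?subrr // => i ij.
  by rewrite -jm (inj_eq mon_inj) (negbTE ij) mulr0.
rewrite mcoeffB coefsum big1 ?subr0 => [|i _]; last first.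
  by move/existsPn: noj => /(_ i)/negbTE ->; rewrite mulr0.
rewrite mcoeff_eq0; apply/negP => /msize_mdeg_lt/leq_trans/(_ (szb t)) degm.
have mle v : (m v < e.+1)%N.
  by apply: leq_ltn_trans degm; rewrite mdegE (bigD1 v) ?leq_addr.
pose F := [ffun v => Ordinal (mle v)].
have BF : F \in B.
  apply/pffun_onP; split=> [|y _ //].
  apply/fintype.subsetP => v; rewrite !inE ffunE; apply: contra => vC.
  by apply/eqP/val_inj; rewrite /= wm0.
case/existsP: noj; exists (enum_rank_in BF F); apply/eqP/mnmP => v.
by rewrite mnmE enum_rankK_in // ffunE.
Qed.

(** Compare the two growth rates in M: M ^ k independent elements in degree at
    most M * c, against (M * c + 1) ^ (n - #|C|). *)
Lemma prime_chain_le C k (Q : nat -> set S) :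
  prime_chain k Q -> var_ideal C `<=` Q 0%N -> (k <= n - #|C|)%N.
Proof.
move=> chQ CQ; have [c hc] := prime_chain_free chQ.
have /prime_idealP[idQ _ _] : prime_ideal (Q 0%N) by case: chQ => + _; apply.
set d := (n - #|C|)%N; rewrite leqNgt; apply/negP => dk.
(* With d < k, M ^ k >= M ^ d * M, and this M exceeds c.+1 ^ d. *)
pose M := (c.+1 ^ d).+1; have [T [b [cT freeb szb]]] := hc M.
have := free_mod_var_ideal_le idQ CQ freeb szb; rewrite cT leqNgt => /negP; apply.
have M0 : (0 < M)%N by [].
have Mc : ((M * c).+1 ^ d <= (M * c.+1) ^ d)%N by apply: leq_expn2r; rewrite mulnS; lia.
apply: leq_ltn_trans Mc _; rewrite expnMn.
apply: (@leq_trans (M ^ d.+1)%N); last by rewrite leq_pexp2l.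
by rewrite expnSr ltn_pmul2l ?expn_gt0 // /M.
Qed.

End KrullDimension.

(** * Krull dimension and height via monomial primes *)

Lemma set_max_eq (disp : Order.disp_t) (T : porderType disp) (x0 x : T) (A : set T) :
  A x -> ubound A x -> set_max x0 A = x.
Proof.
move=> Ax ux; apply: xget_unique => // y [Ay uy].
by apply: le_anti; rewrite ux ?uy.
Qed.

Section MonomialPrimes.
Variables (K : fieldType) (n : nat).
Local Notation S := {mpoly K[n]}.
Implicit Types (C : {set 'I_n}) (P J : set S) (f : S).

Lemma var_ideal_sub C C' : C \subset C' -> @var_ideal K n C `<=` var_ideal C'.
Proof.
move=> CC' f Cf m /Cf/weight_neq0P[v vC mv]; apply/weight_neq0P; exists v => //.
exact: (fintype.subsetP CC').
Qed.

Lemma var_idealX C v : @var_ideal K n C 'X_v <-> v \in C.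
Proof.
rewrite /var_ideal mon_idealX; split.
  by move=> /weight_neq0P[w wC]; rewrite mnm1E eqb0 negbK => /eqP ->.
by move=> vC; apply/weight_neq0P; exists v; rewrite // mnm1E eqxx.
Qed.

Lemma var_ideal_proper C C' : C \proper C' -> @var_ideal K n C `<` var_ideal C'.
Proof.
move=> /fintype.properP[CC' [v vC' vC]]; split; first exact: var_ideal_sub.
by move=> /(_ 'X_v); rewrite !var_idealX => /(_ vC'); apply/negP.
Qed.

(** Adjoining the variables outside C one at a time. *)
Lemma var_ideal_chain C : exists Q : nat -> {set 'I_n},
  Q 0%N = C /\ forall i, (i < n - #|C|)%N -> Q i \proper Q i.+1.
Proof.
pose xs := enum (~: C)%SET; exists (fun i => C :|: [set x in take i xs])%SET.
split=> [|i iC].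
  by apply/setP => v; rewrite !inE take0 in_nil orbF.
have ixs : (i < size xs)%N.
  by rewrite -cardE [#|_|]cardsCs finset.setCK card_ord.
have v0 : 'I_n by case: xs ixs => // v.
have ev := take_nth v0 ixs; apply/fintype.properP; split.
  apply/fintype.subsetP => v; rewrite !inE ev mem_rcons inE.
  by move=> /orP[->//|->]; rewrite !orbT.
exists (nth v0 xs i); first by rewrite !inE ev mem_rcons mem_head orbT.
rewrite !inE negb_or; apply/andP; split.
  by have := mem_nth v0 ixs; rewrite mem_enum inE.
have := take_uniq i.+1 (enum_uniq (~: C)%SET).
by rewrite -/xs ev rcons_uniq => /andP[].
Qed.

Lemma quot_krull_dim_eq C J : J `<=` var_ideal C ->
  (forall P, prime_ideal P -> J `<=` P ->
     exists2 C' : {set 'I_n}, #|C'| = #|C| & var_ideal C' `<=` P) ->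
  quot_krull_dim J = (n - #|C|)%N.
Proof.
move=> JC Jprimes; apply: set_max_eq.
  have [Q [Q0 Qlt]] := var_ideal_chain C.
  exists (fun i => var_ideal (Q i)); split; last by rewrite Q0.
  split=> i ilt; first exact: var_ideal_prime.
  exact/var_ideal_proper/Qlt.
move=> k [Q [chQ JQ]].
have [C' <- C'Q] : exists2 C' : {set 'I_n}, #|C'| = #|C| & var_ideal C' `<=` Q 0%N.
  by apply: Jprimes => //; case: chQ => + _; apply.
exact: prime_chain_le chQ C'Q.
Qed.

(** A chain below the prime continues above it by adjoining the remaining
    variables; the total length is at most n. *)
Lemma prime_height_var_ideal C : (prime_height (@var_ideal K n C) <= #|C|)%N.
Proof.
suff bound (k : nat) : (exists Q, prime_chain k Q /\ Q k = @var_ideal K n C) -> (k <= #|C|)%N.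
  by rewrite /prime_height /set_max; case: xgetP => // k _ [/bound].
move=> [Q [[Qprime Qlt] Qk]].
have [V [V0 Vlt]] := var_ideal_chain C.
pose R i := if (i <= k)%N then Q i else var_ideal (V (i - k)%N).
have chR : prime_chain (k + (n - #|C|)) R.
  split=> i ik; rewrite /R.
    by case: leqP => [/Qprime//|_]; apply: var_ideal_prime.
  case: (ssrnat.ltngtP i k) => [/Qlt//|ki|ki].
    rewrite subSn; last exact: ltnW.
    by apply/var_ideal_proper/Vlt; rewrite ltn_subLR // ltnW.
  rewrite ki subSnn Qk -V0; apply/var_ideal_proper/Vlt.
  by move: ik; rewrite ki -[X in (X < _)%N]addn0 ltn_add2l.
have sub0 : var_ideal finset.set0 `<=` R 0%N.
  move=> f f0; suff -> : f = 0.
    by have /prime_idealP[[]] : prime_ideal (R 0%N) by case: chR => + _; apply.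
  apply/mpolyP => m; rewrite mcoeff0; apply/eqP; rewrite mcoeff_eq0.
  by apply/negP => /f0; rewrite /weight big_set0.
have := prime_chain_le chR sub0; have := max_card (mem C).
rewrite card_ord cards0 subn0 => Cn kn.
by rewrite -(leq_add2r (n - #|C|)) (subnKC Cn).
Qed.

(** The height is a minimum over the primes above J, and this prime is one of
    them. *)
Lemma height_le C J : J `<=` @var_ideal K n C -> (height J <= #|C|)%N.
Proof.
move=> JC; apply: leq_trans (prime_height_var_ideal C).
rewrite /height /set_min; case: xgetP => // k _ [_]; apply.
by exists (var_ideal C) => //; split=> //; apply: var_ideal_prime.
Qed.

End MonomialPrimes.

(** * Complete intersections of monomials have disjoint supports *)

Section MonomialGenerators.
Variables (K : fieldType) (n r : nat) (alpha : 'I_r -> 'X_{1..n}).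
Local Notation S := {mpoly K[n]}.
Implicit Types (C : {set 'I_n}) (P J : set S) (f : S) (m : 'X_{1..n}).

Definition divisible : pred 'X_{1..n} := fun m => [exists i, (alpha i <= m)%MM].

Definition monI : set S := @mon_ideal K n divisible.

Lemma divisible_up : up_closed divisible.
Proof.
move=> m m' /existsP[i im] mm'; apply/existsP; exists i; exact: lepm_trans im mm'.
Qed.

Lemma monI_ideal : is_ideal monI.
Proof. exact/mon_ideal_ideal/divisible_up. Qed.

Lemma divisible_gen i : divisible (alpha i).
Proof. by apply/existsP; exists i; apply: lepm_refl. Qed.

Lemma monI_gen i : monI 'X_[alpha i].
Proof. exact/mon_idealX/divisible_gen. Qed.

Lemma ideal_gen_range_monI : ideal_gen (range (fun i => 'X_[K, alpha i])) = monI.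
Proof.
rewrite -[RHS](@ideal_gen_monomials _ _ (range alpha)); last 2 first.
- exact: divisible_up.
- move=> m; split=> [/existsP[i im]|[_ [i _ <-] im]]; first by exists (alpha i).
  by apply/existsP; exists i.
congr ideal_gen; apply/seteqP; split=> [_ [i _ <-]|_ [_ [i _ <-] <-]].
  by exists (alpha i).
by exists i.
Qed.

(** A generator divisible by another one could be dropped. *)
Lemma minimal_antichain : minimal_generators (fun i => 'X_[K, alpha i]) monI ->
  forall i j, (alpha i <= alpha j)%MM -> i = j.
Proof.
move=> [_ minI] i j ij; apply/eqP/negPn/negP => neq.
have prop : ([set: 'I_r] :\ j)%SET \proper [set: 'I_r]%SET.
  by rewrite properD1 ?inE.
apply: (minI _ prop); apply/seteqP; split; last first.
  by apply: ideal_gen_sub; [exact: monI_ideal|move=> _ [l _ <-]; apply: monI_gen].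
rewrite -ideal_gen_range_monI; apply: ideal_gen_sub; first exact: ideal_gen_ideal.
move=> _ [l _ <-]; have [->|lj] := eqVneq l j; last first.
  by apply: sub_ideal_gen; exists l => //=; rewrite !inE lj.
rewrite -(submK ij) mpolyXD; apply: idealM; first exact: ideal_gen_ideal.
by apply: sub_ideal_gen; exists i => //=; rewrite !inE neq.
Qed.

Lemma ideal_gen_rangeP h (g : 'I_h -> S) f :
  ideal_gen (range g) f -> exists c : 'I_h -> S, f = \sum_l c l * g l.
Proof.
move: f; pose J : set S := [set f | exists c : 'I_h -> S, f = \sum_l c l * g l].
apply: (@ideal_gen_sub _ _ _ J); first split.
- by exists (fun=> 0); rewrite big1 // => l _; rewrite mul0r.
- move=> a _ _ [c1 ->] [c2 ->]; exists (fun l => a * c1 l + c2 l).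
  by rewrite mulr_sumr -big_split; apply: eq_bigr => l _; rewrite mulrDl mulrA.
move=> _ [l _ <-]; exists (fun k => (k == l)%:R).
rewrite (bigD1 l) //= eqxx mul1r big1 ?addr0 // => k /negbTE ->.
by rewrite mul0r.
Qed.

(** A form of Nakayama's lemma. The coefficient of c * g at alpha i, for g in
    the ideal, is c(0) times that of g, since no proper divisor of t^alpha_i
    lies in the ideal. Hence the identity matrix of size r factors through a
    space of dimension h. *)
Lemma antichain_gen_le h (g : 'I_h -> S) :
  (forall i j, (alpha i <= alpha j)%MM -> i = j) ->
  monI = ideal_gen (range g) -> (r <= h)%N.
Proof.
move=> anti eI.
have gI l : monI (g l) by rewrite eI; apply: sub_ideal_gen; exists l.
have /choice[c hc] i : exists c : 'I_h -> S, 'X_[alpha i] = \sum_l c l * g l.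
  by apply: ideal_gen_rangeP; rewrite -eI; apply: monI_gen.
pose A := \matrix_(i < r, l < h) (c i l)@_0%MM.
pose B := \matrix_(l < h, i < r) (g l)@_(alpha i).
suff AB : A *m B = 1%:M.
  rewrite -(mxrank1 K r) -AB; apply: leq_trans (mxrankM_maxl _ _) _.
  exact: rank_leq_col.
apply/matrixP => i j; rewrite !mxE.
have := congr1 (mcoeff (alpha j)) (hc i); rewrite mcoeffX raddf_sum /=.
have -> : (alpha i == alpha j) = (i == j).
  apply/eqP/eqP => [eij|-> //]; apply: anti; rewrite eij; exact: lepm_refl.
move=> ->; apply: eq_bigr => l _; rewrite !mxE -mcoeffM_unique ?add0m //.
move=> k1 k2 _ /gI /existsP[j' jk2] ek.
have jj' : j' = j.
  by apply/anti/(lepm_trans jk2); rewrite -ek lem_addl.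
move: jk2 ek; rewrite jj' => /submK <-.
move=> /(congr1 mdeg); rewrite !mdegD => ek.
have /eqP : mdeg k1 = 0%N by lia.
have /eqP : mdeg (k2 - alpha j)%MM = 0%N by lia.
by rewrite !mdeg_eq0 => /eqP -> /eqP ->; rewrite add0m.
Qed.

Definition transversal_vars (t : 'I_r -> 'I_n) : Prop := forall i, alpha i (t i) != 0%N.

Definition vars (t : 'I_r -> 'I_n) : {set 'I_n} := [set t i | i : 'I_r]%SET.

Lemma monI_sub_var_ideal t : transversal_vars t -> monI `<=` var_ideal (vars t).
Proof.
move=> ht f If m /If /existsP[i /mnm_lepP/(_ (t i)) im]; apply/weight_neq0P.
exists (t i); first exact: imset_f.
by rewrite -lt0n (leq_trans _ im) // lt0n.
Qed.

Lemma exists_transversal : (forall i, alpha i != 0%MM) ->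
  exists t, transversal_vars t.
Proof.
move=> nz; suff /choice[t ht] : forall i, exists v, alpha i v != 0%N by exists t.
move=> i; apply/existsP; rewrite -[[exists _, _]]negbK negb_exists.
apply: contra (nz i) => /forallP h; apply/eqP/mnmP => v.
by rewrite mnm0E; apply/eqP; rewrite -[_ == _]negbK.
Qed.

Definition disjoint_supports : Prop :=
  forall i j v, alpha i v != 0%N -> alpha j v != 0%N -> i = j.

Lemma vars_card t : disjoint_supports -> transversal_vars t -> #|vars t| = r.
Proof.
move=> disj ht; rewrite card_imset ?card_ord // => i j tij.
by apply: (disj _ _ (t i)) => //; rewrite tij.
Qed.

(** If v lay in two supports, a choice of one variable per support using v twice
    would give a prime of height less than r above the ideal. But the height is
    at least r, since fewer than r elements do not generate the ideal. *)
Lemma complete_intersection_disjoint : (forall i, alpha i != 0%MM) ->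
  minimal_generators (fun i => 'X_[K, alpha i]) monI ->
  complete_intersection monI -> disjoint_supports.
Proof.
move=> nz minI [g eI] i j v iv jv; apply/eqP/negPn/negP => neq.
have [t0 ht0] := exists_transversal nz.
pose t k := if (k == i) || (k == j) then v else t0 k.
have ht : transversal_vars t.
  by move=> k; rewrite /t; have [->//|_ /=] := eqVneq k i; have [->|] := eqVneq k j.
have := antichain_gen_le (minimal_antichain minI) eI.
rewrite leqNgt => /negP; apply.
apply: leq_ltn_trans (height_le (monI_sub_var_ideal ht)) _.
have := leq_imset_card t 'I_r; rewrite card_ord leq_eqVlt => /predU1P[cr|//].
exfalso; move: cr; rewrite -[X in _ = X](card_ord r) => /eqP.
move=> /imset_injP inj; case/eqP: neq; apply: inj => //.
by rewrite /t !eqxx orbT.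
Qed.

(** By induction on the degree, splitting off one variable. *)
Lemma prime_monomial P m : prime_ideal P -> P 'X_[m] ->
  exists2 v, m v != 0%N & P 'X_v.
Proof.
move=> /prime_idealP[_ nP1 Pmul]; have [e] := ubnP (mdeg m).
elim: e m => // e IH m me Pm.
have [m0|] := eqVneq m 0%MM; first by move: Pm; rewrite m0 mpolyX0.
move=> nzm; have [v mv] : exists v, m v != 0%N.
  apply/existsP; rewrite -[[exists _, _]]negbK negb_exists.
  apply: contra nzm => /forallP h; apply/eqP/mnmP => v.
  by rewrite mnm0E; apply/eqP; rewrite -[_ == _]negbK.
have Um : (U_(v) <= m)%MM by rewrite lep1mP.
move: Pm; rewrite -(submK Um) mpolyXD => /Pmul[/IH|Pv]; last first.
  by exists v; rewrite // submK.
move=> []; first by move: me; rewrite -{1}(submK Um) mdegD mdeg1; lia.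
by move=> w hw Pw; exists w; rewrite // mnmDE; lia.
Qed.

(** Every prime above J contains a variable from each support, hence one of the
    primes generated by r variables. *)
Lemma quot_krull_dim_monI J t : disjoint_supports -> transversal_vars t ->
  monI `<=` J -> J `<=` var_ideal (vars t) -> quot_krull_dim J = (n - r)%N.
Proof.
move=> disj ht IJ Jt; rewrite (quot_krull_dim_eq Jt) ?vars_card // => P primeP JP.
have /choice[u hu] i : exists v, alpha i v != 0%N /\ P 'X_v.
  have [|v iv Pv] := prime_monomial (m := alpha i) primeP; last by exists v.
  exact/JP/IJ/monI_gen.
exists (vars u); first by rewrite vars_card // => i; have [] := hu i.
have [idP _ _] := prime_idealP primeP.
move=> f; apply: mon_ideal_span => // m /weight_neq0P[_ /imsetP[i _ ->] mi].
rewrite -[m](@submK _ U_(u i)) ?lep1mP // mpolyXD; apply: idealM => //.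
by have [] := hu i.
Qed.

Lemma colon_neq J f : is_ideal J -> colon J f <> J -> exists2 h, ~ J h & J (h * f).
Proof.
move=> idJ neq; apply: contrapT => H; apply: neq; apply/seteqP; split=> h; last first.
  by rewrite /colon /= mulrC; apply: idealM.
by move=> Jhf; apply: contrapT => nJh; apply: H; exists h.
Qed.

(** Choose h outside I with f h in I, and a monomial m of h outside I. For each
    i some exponent of m is smaller than that of alpha i, at t i say. The powers
    of the variables t i with exponents alpha i (t i) generate a primary ideal
    that contains I but not h, so f must lie in its radical. *)
Lemma zero_divisor_var_ideal f : colon monI f <> monI ->
  exists2 t, transversal_vars t & var_ideal (vars t) f.
Proof.
move=> /(colon_neq monI_ideal)[h nIh Ihf].
have /existsNP[m /not_implyP[mh /negP/existsPn nm]] := nIh.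
have /choice[t ht] i : exists v, (m v < alpha i v)%N.
  apply: contrapT => H; case/negP: (nm i); apply/mnm_lepP => v.
  by rewrite leqNgt; apply/negP => ?; apply: H; exists v.
have tt : transversal_vars t by move=> i; have := ht i; lia.
exists t => //; apply: contrapT => nf.
(* Membership in the primary ideal generated by the pure powers. *)
pose A m' := [exists i, alpha i (t i) <= m' (t i)]%N.
have upA : up_closed A.
  move=> m1 m2 /existsP[i im1] /mnm_lepP m12; apply/existsP; exists i.
  exact: leq_trans im1 (m12 _).
apply: (@mon_ideal_primary _ _ (vars t) A h f upA _ _ nf).
- move=> m1 m2 /existsP[i im] w0; apply/existsP; exists i; move: im.
  suff -> : (m1 + m2)%MM (t i) = m1 (t i) by [].
  rewrite mnmDE; suff -> : m2 (t i) = 0%N by rewrite addn0.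
  apply/eqP; move/eqP: w0; rewrite /weight sum_nat_eq0 => /forallP/(_ (t i)).
  by rewrite imset_f.
- move=> /(_ m mh) /existsP[i]; have := ht i; lia.
by move=> m' /Ihf /existsP[i /mnm_lepP im]; apply/existsP; exists i.
Qed.

(** If m involves t i, then it is annihilated by the proper divisor alpha i -
    U_(t i) of alpha i, which lies outside the ideal because supports are
    disjoint. *)
Lemma var_ideal_zero_divisor t m : disjoint_supports ->
  transversal_vars t -> ~~ divisible m -> weight (vars t) m != 0%N ->
  colon monI 'X_[m] <> monI.
Proof.
move=> disj ht nm /weight_neq0P[_ /imsetP[i _ ->] mi] eqI.
pose q := (alpha i - U_(t i))%MM.
have Ui : (U_(t i) <= alpha i)%MM by rewrite lep1mP.
have nq : ~ monI 'X_[q].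
  move=> /mon_idealX/existsP[j /mnm_lepP jq].
  have ij : i = j.
    apply: disj (ht j); rewrite -lt0n; apply: leq_trans (leq_trans (jq (t j)) _).
      by rewrite lt0n.
    by rewrite mnmBE leq_subr.
  have := jq (t i); rewrite -ij mnmBE mnm1E eqxx.
  by have := ht i; lia.
apply: nq; rewrite -eqI /colon /= -mpolyXD; apply/mon_idealX/existsP; exists i.
have Um : (U_(t i) <= m)%MM by rewrite lep1mP.
rewrite -(submK Um) addmA [(q + _)%MM]addmC -addmA submK //.
exact: lem_addl.
Qed.

End MonomialGenerators.

(** * Hilbert functions and standard monomials *)

Section HilbertFunctions.
Variables (K : fieldType) (n : nat).
Local Notation S := {mpoly K[n]}.
Implicit Types (J : set S) (f v w : S) (m : 'X_{1..n}) (A : pred 'X_{1..n}).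

Definition monomials d : seq 'X_{1..n} :=
  [seq s2m t | t : d.-tuple 'I_n <- enum (mpoly.basis n d)].

Lemma mem_monomials d m : (m \in monomials d) = (mdeg m == d).
Proof. by rewrite basis_cover. Qed.

Lemma monomials_uniq d : uniq (monomials d).
Proof. exact: uniq_basis. Qed.

Definition std_monomials A d : seq 'X_{1..n} := [seq m <- monomials d | ~~ A m].

Lemma mem_std_monomials A d m :
  (m \in std_monomials A d) = ~~ A m && (mdeg m == d).
Proof. by rewrite mem_filter mem_monomials. Qed.

Lemma mpoly_sum_nth (L : seq 'X_{1..n}) v : uniq L -> {subset msupp v <= L} ->
  v = \sum_(j < size L) v@_(nth 0%MM L j) *: 'X_[nth 0%MM L j].
Proof.
move=> uL vL; rewrite -(big_mkord xpredT (fun j => v@_(nth 0%MM L j) *: 'X_[nth 0%MM L j])).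
rewrite -(big_nth 0%MM xpredT (fun m => v@_m *: 'X_[m])).
apply/mpolyP => m; rewrite raddf_sum /=.
under eq_bigr do rewrite mcoeffZ mcoeffX.
have [mL|mL] := boolP (m \in L).
  rewrite (bigD1_seq m) //= eqxx mulr1 big1 ?addr0 // => m' /negbTE ->.
  by rewrite mulr0.
rewrite big_seq big1 => [|m' m'L]; last first.
  by have /negbTE -> : m' != m; [apply: contraNneq mL => <-|rewrite mulr0].
by apply/memN_msupp_eq0; apply: contra mL; apply: vL.
Qed.

Lemma homog_subspace d : is_subspace (@homog_part K n d).
Proof.
by split=> [|a u v hu hv]; rewrite /homog_part /= ?rpred0 // rpredD ?rpredZ.
Qed.

Lemma ideal_homog_subspace J d : is_ideal J -> is_subspace (J `&` homog_part d).
Proof.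
move=> /ideal_subspace[J0 JD]; have [h0 hD] := homog_subspace d.
by split=> // a u v [Ju hu] [Jv hv]; split; [apply: JD|apply: hD].
Qed.

Lemma homog_std A d v : homog_part d v -> (forall m, m \in msupp v -> ~~ A m) ->
  {subset msupp v <= std_monomials A d}.
Proof.
move=> /dhomogP hv nA m mv; rewrite mem_std_monomials nA //.
by apply/eqP/hv.
Qed.

(** A reduction of homogeneous polynomials to standard monomials bounds the
    Hilbert function, whether or not the standard monomials are independent
    modulo J. *)
Lemma hilbert_function_le J A d : is_ideal J ->
  (forall v, homog_part d v -> exists w, [/\ J w, homog_part d w &
      forall m, m \in msupp (v - w) -> ~~ A m]) ->
  (hilbert_function J d <= size (std_monomials A d))%N.
Proof.
move=> idJ hred.
apply: (quot_dim_le (g := fun j => 'X_[nth 0%MM (std_monomials A d) j])).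
- exact: homog_subspace.
- exact: ideal_homog_subspace.
move=> v hv; have [w [Jw hw nA]] := hred v hv.
have hvw : homog_part d (v - w) by rewrite /homog_part /= rpredB.
exists (fun j => (v - w)@_(nth 0%MM (std_monomials A d) j)).
rewrite -mpoly_sum_nth ?subKr //; first exact/filter_uniq/monomials_uniq.
exact: homog_std.
Qed.

Lemma hilbert_mon_ideal A d : up_closed A ->
  hilbert_function (@mon_ideal K n A) d = size (std_monomials A d).
Proof.
move=> upA; have idA := mon_ideal_ideal K upA.
pose L := std_monomials A d; have uL : uniq L by apply/filter_uniq/monomials_uniq.
have LA (j : 'I_(size L)) : ~~ A (nth 0%MM L j) /\ mdeg (nth 0%MM L j) = d.
  have := mem_nth 0%MM (ltn_ord j); rewrite mem_std_monomials.
  by move=> /andP[? /eqP].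
apply: (quot_dim_basis (b := fun j => 'X_[nth 0%MM L j])).
- exact: homog_subspace.
- exact: ideal_homog_subspace.
apply: quot_basisP.
- exact: ideal_homog_subspace.
- by move=> j; rewrite /homog_part /= dhomogX; apply/eqP; have [] := LA j.
- move=> c [Ac _] j; apply/eqP; apply: contraT => cj.
  have [/negP] := LA j; case; apply: Ac.
  rewrite mcoeff_msupp raddf_sum /= (bigD1 j) //= mcoeffZ mcoeffX eqxx mulr1.
  rewrite big1 ?addr0 // => i ij; rewrite mcoeffZ mcoeffX nth_uniq //.
  by rewrite (inj_eq val_inj) (negbTE ij) mulr0.
move=> v hv; pose q := \sum_(j < size L) v@_(nth 0%MM L j) *: 'X_[nth 0%MM L j].
have qm m : q@_m = if m \in L then v@_m else 0.
  rewrite raddf_sum /=; under eq_bigr do rewrite mcoeffZ mcoeffX.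
  case: ifP => mL.
    have mi : (index m L < size L)%N by rewrite index_mem.
    rewrite (bigD1 (Ordinal mi)) //= nth_index // eqxx mulr1 big1 ?addr0 // => i.
    rewrite -val_eqE /= => ij; rewrite -[X in _ == X](nth_index 0%MM mL) nth_uniq //.
    by rewrite (negbTE ij) mulr0.
  rewrite big1 // => i _; have /negbTE -> : nth 0%MM L i != m; last by rewrite mulr0.
  by apply/negP => /eqP im; move: mL; rewrite -im mem_nth.
exists (fun j => v@_(nth 0%MM L j)); split.
  move=> m; rewrite mcoeff_msupp mcoeffB qm; case: ifP; rewrite ?subrr ?eqxx //.
  rewrite subr0 mem_std_monomials -mcoeff_msupp => + mv.
  by rewrite ((dhomogP _ _ _ hv) m mv) eqxx andbT => /negbFE.
rewrite /homog_part /= rpredB // rpred_sum // => j _; rewrite rpredZ //.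
by rewrite dhomogX; apply/eqP; have [] := LA j.
Qed.

(** Division with respect to f: a monomial divisible by the leading monomial a
    of f is replaced, modulo a multiple of f, by smaller monomials of the same
    degree. There are finitely many of these, so the process stops. *)
Lemma homog_reduce (le : rel 'X_{1..n}) J A f c a d :
  graded_monomial_order le -> is_ideal J -> mon_ideal A `<=` J -> J f ->
  homog_part c f -> is_leading_monomial le f a ->
  forall v, homog_part d v -> exists w, [/\ J w, homog_part d w &
    forall m, m \in msupp (v - w) -> ~~ (A m || (a <= m)%MM)].
Proof.
move=> [[refl_le anti_le tr_le tot_le] [_ le_add _]] idJ AJ Jf hf [af maxf].
pose R : set S := [set v | exists w, [/\ J w, homog_part d w &
  forall m, m \in msupp (v - w) -> ~~ (A m || (a <= m)%MM)]].
have [h0 hD] := homog_subspace d.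
have [J0 JD] := ideal_subspace idJ.
have RJ v : J v -> homog_part d v -> R v.
  by move=> Jv hv; exists v; split=> // m; rewrite subrr msupp0.
have [R0 RD] : is_subspace R.
  split; first exact: RJ.
  move=> b u v [wu [Ju hu nu]] [wv [Jv hv nv]]; exists (b *: wu + wv); split.
  - exact: JD.
  - exact: hD.
  move=> m; rewrite opprD addrACA -scalerBr => /msuppD_le.
  by rewrite mem_cat => /orP[/msuppZ_le/nu|/nv].
suff RX m : mdeg m = d -> R 'X_[m].
  move=> v hv; suff : R v by [].
  rewrite [v]mpolyE big_seq; apply: big_ind => // [u u' Ru Ru'|m mv].
    by rewrite -[u]scale1r; apply: (RD).
  rewrite -[_ *: _]addr0; apply: (RD) => //; apply: RX.
  exact: (dhomogP _ _ _ hv).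
(* Induction on the number of smaller monomials of the same degree. *)
pose below m := count (fun m' => le m' m && (m' != m)) (monomials d).
have [e] := ubnP (below m); elim: e m => // e IH m be md.
have hXm : homog_part d 'X_[K, m] by rewrite /homog_part /= dhomogX; apply/eqP.
have [Am|nAm] := boolP (A m); first by apply: RJ => //; apply/AJ/mon_idealX.
have [am|nam] := boolP (a <= m)%MM; last first.
  exists 0; split=> // m'; rewrite subr0 msuppX inE => /eqP ->.
  by rewrite negb_or nAm.
pose g := f * 'X_[m - a].
have Jg : J g by rewrite /g mulrC; apply: idealM.
have suppg m' : m' \in msupp g -> exists2 k, k \in msupp f & m' = (m - a + k)%MM.
  by rewrite (perm_mem (msuppMX _ _)) => /mapP[k kf ->]; exists k.
have ma : (m - a + a)%MM = m by apply: submK.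
have mdma : (mdeg (m - a)%MM + mdeg a)%N = d by rewrite -mdegD ma.
have hg : homog_part d g.
  apply/dhomogP => m' /suppg[k kf ->] /=; rewrite -mdma mdegD.
  by rewrite ((dhomogP _ _ _ hf) k kf) ((dhomogP _ _ _ hf) a af).
have gm : g@_m = f@_a by rewrite -[X in _@_X]ma mcoeffMX.
have mg : m \in msupp g by rewrite mcoeff_msupp gm -mcoeff_msupp.
have -> : 'X_[m] = (g@_m)^-1 *: g + - (g@_m)^-1 *: (g - g@_m *: 'X_[m]) :> S.
  rewrite scalerBr scalerA mulNr mulVf -?mcoeff_msupp // !scaleNr scale1r opprK.
  by rewrite addrA subrr add0r.
apply: (RD) => //; first exact: RJ.
rewrite -[_ *: _]addr0; apply: (RD) => //.
rewrite {1}[g]mpolyE (bigD1_seq m) ?msupp_uniq //= addrC addrK big_seq_cond.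
apply: big_ind => // [u u' Ru Ru'|m' /andP[m'g m'm]].
  by rewrite -[u]scale1r; apply: (RD).
rewrite -[_ *: _]addr0; apply: (RD) => //; apply: IH; last exact: (dhomogP _ _ _ hg).
have m'le : le m' m.
  by have [k kf ->] := suppg _ m'g; rewrite -{2}ma; apply/le_add/maxf.
rewrite -ltnS; apply: leq_trans be; rewrite ltnS.
have m'd : mdeg m' = d by apply: (dhomogP _ _ _ hg).
rewrite /below -!size_filter.
have sub : {subset m' :: [seq k <- monomials d | le k m' & k != m'] <=
    [seq k <- monomials d | le k m & k != m]}.
  move=> k; rewrite inE !mem_filter mem_monomials => /predU1P[->|].
    by rewrite m'le m'm m'd eqxx.
  move=> /andP[/andP[km' kNm'] ->]; rewrite (tr_le _ _ _ km' m'le) !andbT /=.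
  apply: contraNneq kNm' => ekm; apply/eqP/anti_le.
  by rewrite km' ekm m'le.
apply: (uniq_leq_size _ sub) => /=.
by rewrite mem_filter eqxx andbF /= filter_uniq // monomials_uniq.
Qed.

End HilbertFunctions.

(** * Counting monomials outside a monomial ideal *)

Section Counting.
Variable n : nat.
Implicit Types (m g a : 'X_{1..n}) (gs : seq 'X_{1..n}).

Definition div_by gs : pred 'X_{1..n} := fun m => has (fun g => (g <= m)%MM) gs.

Definition std_count gs e : nat := size (std_monomials (div_by gs) e).

Lemma lem_subLR g a m : (g <= a + m)%MM = (g - a <= m)%MM.
Proof.
by apply/mnm_lepP/mnm_lepP => h v; have := h v; rewrite mnmDE mnmBE leq_subLR.
Qed.

(** Among the monomials outside gs, those divisible by a are the a + m with m
    outside the colon ideal by a, whose generators are the truncated differences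
    g - a. *)
Lemma std_count_cons a gs e : (mdeg a <= e)%N ->
  (std_count (a :: gs) e + std_count [seq (g - a)%MM | g <- gs] (e - mdeg a))%N
  = std_count gs e.
Proof.
move=> ae; rewrite /std_count /std_monomials.
set L := [seq m <- monomials n e | ~~ div_by gs m].
rewrite -[RHS](count_predC (fun m => (a <= m)%MM)) addnC -!size_filter; congr addn.
  rewrite -(size_map (mnm_add a)); apply/perm_size/uniq_perm.
  - by rewrite map_inj_uniq ?filter_uniq ?monomials_uniq //; apply: addmI.
  - by rewrite !filter_uniq // monomials_uniq.
  have divE m' : div_by [seq (g - a)%MM | g <- gs] m' = div_by gs (a + m')%MM.
    by rewrite /div_by has_map; apply: eq_has => g /=; exact/esym/lem_subLR.
  move=> m; rewrite !mem_filter mem_monomials; apply/mapP/andP.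
    move=> [m']; rewrite mem_filter divE mem_monomials => /andP[dm' /eqP em' ->].
    by rewrite lem_addr dm' mdegD em' subnKC ?eqxx.
  move=> [am /andP[dm /eqP em]]; exists (m - a)%MM; last by rewrite addmC submK.
  rewrite mem_filter divE addmC submK // dm mem_monomials /=.
  by rewrite -em -{2}(submK am) mdegD addnK.
rewrite -filter_predI; congr size; apply: eq_filter => m /=.
by rewrite negb_or andbC.
Qed.

Definition mdisjoint : rel 'X_{1..n} :=
  fun a g => [forall v, (a v == 0%N) || (g v == 0%N)].

(** For a monomial with disjoint support the colon ideal is the ideal itself. *)
Lemma mdisjoint_sub a g : mdisjoint a g -> (g - a)%MM = g.
Proof.
move=> /forallP dis; apply/mnmP => v; rewrite mnmBE.
by have /orP[/eqP ->|/eqP ->] := dis v; rewrite ?subn0 ?sub0n.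
Qed.

Lemma std_count_cons_disjoint a gs e : all (mdisjoint a) gs -> (mdeg a <= e)%N ->
  (std_count (a :: gs) e + std_count gs (e - mdeg a))%N = std_count gs e.
Proof.
move=> /allP dis ae; rewrite -[RHS](std_count_cons gs ae); congr (_ + std_count _ _)%N.
rewrite -[LHS]map_id; apply/eq_in_map => g /dis/mdisjoint_sub -> //.
Qed.

End Counting.

(** * Eventually polynomial functions *)

Section EventuallyPolynomial.

(** The degree of p is allowed to be smaller than k. The normalisation makes c
    the limit of k! H(e) / e ^ k, that is, the multiplicity. *)
Definition ev_poly (H : nat -> nat) (k : nat) (c : int) : Prop :=
  exists p : {poly rat}, [/\ forall j, (k < j)%N -> p`_j = 0,
    p`_k * k`!%:R = c%:~R &
    exists E, forall e, (E <= e)%N -> (H e)%:R = p.[e%:R]].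

(** Taylor's formula at x with increment - D; only its first two terms reach the
    two top coefficients. *)
Lemma poly_shift (p : {poly rat}) (D : rat) k :
  (forall j, (k.+1 < j)%N -> p`_j = 0) ->
  exists q : {poly rat}, [/\ forall x, q.[x] = p.[x - D],
    forall j, (k < j)%N -> q`_j = p`_j &
    q`_k = p`_k - k.+1%:R * D * p`_k.+1].
Proof.
move=> p0; exists (\sum_(i < size p) (- D) ^+ i *: p^`N(i)).
have coefq j : (\sum_(i < size p) (- D) ^+ i *: p^`N(i))`_j =
    \sum_(i < k.+3) (- D) ^+ i * (p`_(i + j) *+ 'C(i + j, i)).
  rewrite coef_sum; under eq_bigr do rewrite coefZ coef_nderivn.
  have sz : (size p <= k.+3)%N by apply: leq_trans (leqnSn _); apply/leq_sizeP => i; apply: p0.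
  rewrite (big_ord_widen _ (fun i => (- D) ^+ i * (p`_(i + j) *+ 'C(i + j, i))) sz).
  rewrite big_mkcond; apply: eq_bigr => i _; case: ltnP => // szi.
  by rewrite nth_default ?mul0rn ?mulr0 // (leq_trans szi) ?leq_addr.
split.
- move=> x; rewrite nderiv_taylor ?horner_sum; last exact: mulrC.
  by apply: eq_bigr => i _; rewrite hornerZ mulrC.
- move=> j kj; rewrite coefq big_ord_recl big1 ?addr0 => [|i _].
    by rewrite expr0 mul1r add0n bin0.
  by rewrite p0 ?mul0rn ?mulr0 // lift0; lia.
rewrite coefq 2!big_ord_recl big1 ?addr0 => [|i _]; last first.
  by rewrite p0 ?mul0rn ?mulr0 // !lift0; lia.
rewrite !lift0 expr0 mul1r add0n bin0 expr1 add1n bin1 mulr1n; congr (_ + _).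
by rewrite -[p`_k.+1 *+ _]mulr_natl; ring.
Qed.

(** A difference of step D lowers the degree by one and multiplies the leading
    coefficient by (k + 1) D, which becomes the factor D after normalisation by
    the factorials. *)
Lemma ev_poly_diff H H' k c D : ev_poly H k.+1 c ->
  (forall e, (D <= e)%N -> (H' e + H (e - D) = H e)%N) ->
  ev_poly H' k (c * D%:Z).
Proof.
move=> [p [p0 pc [E hE]]] hH'; have [q [qx qj qk]] := poly_shift D%:R p0.
exists (p - q); split.
- by move=> j kj; rewrite coefB qj // subrr.
- rewrite coefB qk opprB addrC subrK rmorphM /= -pc factS natrM.
  by ring.
exists (E + D)%N => e eE; rewrite hornerD hornerN qx -natrB; last by lia.
rewrite -hE; last by lia.
rewrite -hE; last by lia.
by rewrite -(hH' e) ?natrD ?addrK //; lia.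
Qed.

Lemma ev_poly_sub H1 H2 H k c1 c2 D : ev_poly H1 k c1 -> ev_poly H2 k c2 ->
  (forall e, (D <= e)%N -> (H e + H2 (e - D) = H1 e)%N) ->
  ev_poly H k (c1 - c2).
Proof.
move=> [p1 [p10 pc1 [E1 hE1]]] [p2 [p20 pc2 [E2 hE2]]] hH.
have p20' j : (k.+1 < j)%N -> p2`_j = 0 by move=> ?; apply: p20; lia.
have [q [qx qj qk]] := poly_shift D%:R p20'.
exists (p1 - q); split.
- by move=> j kj; rewrite coefB qj // p10 // p20 // subrr.
- rewrite coefB qk (p20 k.+1) // mulr0 subr0 rmorphB /= -pc1 -pc2; ring.
exists (E1 + E2 + D)%N => e eE; rewrite hornerD hornerN qx -natrB; last by lia.
rewrite -hE1; last by lia.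
rewrite -hE2; last by lia.
by rewrite -(hH e) ?natrD ?addrK //; lia.
Qed.

(** The number of monomials of degree e in n + 1 variables is the binomial
    coefficient 'C(e + n, n), a polynomial in e with roots -1, ..., -n. *)
Lemma ev_poly_monomials n : ev_poly (@std_count n.+1 [::]) n 1.
Proof.
pose q : {poly rat} := \prod_(i < n) ('X - (i%:R - n%:R)%:P).
have szq : size q = n.+1 by rewrite size_prod_XsubC /index_enum -enumT size_enum_ord.
exists (n`!%:R^-1 *: q); split.
- by move=> j nj; rewrite coefZ nth_default ?mulr0 // szq.
- have /monicP := monic_prod_XsubC (index_enum 'I_n) xpredT (fun i => i%:R - n%:R : rat).
  rewrite /lead_coef -/q szq /= coefZ => ->.
  by rewrite mulr1 mulVf // pnatr_eq0 -lt0n fact_gt0.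
exists 0%N => e _; rewrite hornerZ.
have -> : @std_count n.+1 [::] e = 'C(e + n, n).
  have /all_filterP : all (fun m => ~~ div_by [::] m) (monomials n.+1 e) by apply/allP.
  move=> eL; rewrite /std_count [std_monomials _ _]eL.
  by rewrite -[RHS]bin_sub ?leq_addl // addnK -size_basis.
have -> : q.[e%:R] = ((e + n) ^_ n)%:R.
  rewrite ffact_prod natr_prod horner_prod; apply: eq_bigr => i _.
  rewrite hornerXsubC natrB ?natrD; last by have := ltn_ord i; lia.
  by ring.
by rewrite -bin_ffact natrM mulrC mulfK // pnatr_eq0 -lt0n fact_gt0.
Qed.

(** Each further generator with disjoint support takes a difference of step its
    degree. *)
Lemma ev_poly_std_count n (gs : seq 'X_{1..n.+1}) :
  pairwise (@mdisjoint n.+1) gs -> (size gs <= n)%N ->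
  ev_poly (std_count gs) (n - size gs) (\prod_(g <- gs) (mdeg g)%:Z).
Proof.
elim: gs => [|a gs IH]; first by rewrite big_nil subn0 => _ _; apply: ev_poly_monomials.
rewrite pairwise_cons => /andP[dis pw] szgs.
rewrite big_cons mulrC; apply: (@ev_poly_diff (std_count gs)).
  rewrite [(n - _).+1](_ : _ = (n - size gs)%N); last by rewrite /= in szgs *; lia.
  by apply: IH pw _; apply: ltnW.
by move=> e ae; apply: std_count_cons_disjoint.
Qed.

End EventuallyPolynomial.

(** * Degrees as limits *)

Section Degree.

Lemma half_gap_lt (u v x y : rat) : y + 1 <= x -> x - u < 1 / 2%:R ->
  - (1 / 2%:R) < y - v -> u <= v -> False.
Proof. lra. Qed.

(** Integer limits that differ do so by at least 1, so it is enough to compare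
    within 1 / 2. *)
Lemma cvg_int_le (f g : nat -> rat^o) (a b : int) : (forall d, f d <= g d) ->
  f @ \oo --> (a%:~R : rat^o) -> g @ \oo --> (b%:~R : rat^o) -> a <= b.
Proof.
move=> fg /cvgrPdist_lt fa /cvgrPdist_lt gb; rewrite leNgt; apply/negP => ba.
have e0 : (0 : rat) < 1 / 2%:R by lra.
have [N1 _ h1] := fa _ e0; have [N2 _ h2] := gb _ e0.
have {}h1 := h1 (maxn N1 N2) (leq_maxl _ _).
have {}h2 := h2 (maxn N1 N2) (leq_maxr _ _).
have := fg (maxn N1 N2); move: h1 h2 => /=; rewrite !ltr_norml.
have : b%:~R + 1 <= a%:~R :> rat by rewrite -[1]/(1%:~R) -intrD ler_int lezD1.
move=> ab /andP[l1 l2] /andP[l3 l4] l5.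
exact: half_gap_lt ab l2 l3 l5.
Qed.

(** The lower coefficients contribute at most B / d. *)
Lemma ev_poly_cvg H k c : ev_poly H k c ->
  (fun d : nat => k`!%:R * ((H d)%:R / d%:R ^+ k) : rat^o) @ \oo -->
    (c%:~R : rat^o).
Proof.
move=> [p [p0 pc [E hE]]]; apply/cvgrPdist_lt => e e0.
pose B : rat := k`!%:R * \sum_(i < k) `|p`_i|.
have B0 : 0 <= B by rewrite mulr_ge0 ?ler0n // sumr_ge0.
pose N := (Num.truncn (B / e)).+1.
have NB : B / e < N%:R by apply: truncnS_gt.
exists (maxn E N.+1) => // d /=; rewrite geq_max => /andP[Ed Nd].
have d0 : 0 < d%:R :> rat by rewrite ltr0n; lia.
have d1 : 1 <= d%:R :> rat by rewrite ler1n; lia.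
have dk0 i : d%:R ^+ i != 0 :> rat by rewrite expf_neq0 // gt_eqF.
have szp : (size p <= k.+1)%N by apply/leq_sizeP => j; apply: p0.
have -> : c%:~R - k`!%:R * ((H d)%:R / d%:R ^+ k) =
    - (k`!%:R * \sum_(i < k) p`_i * (d%:R ^+ i / d%:R ^+ k)) :> rat.
  rewrite -pc hE // (horner_coef_wide _ szp) big_ord_recr /= mulrDl mulfK //.
  rewrite mulr_suml mulrDr opprD addrC [_ * p`_k]mulrC.
  rewrite -addrA addNr addr0; congr (- (_ * _)).
  by apply: eq_bigr => i _; rewrite mulrA.
rewrite normrN normrM ger0_norm ?ler0n //.
apply: (@le_lt_trans _ _ (B / d%:R)); last first.
  rewrite ltr_pdivrMr // mulrC -ltr_pdivrMr //; apply: lt_trans NB _.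
  by rewrite ltr_nat.
rewrite /B -mulrA ler_wpM2l ?ler0n //; apply: le_trans (ler_norm_sum _ _ _) _.
rewrite mulr_suml; apply: ler_sum => i _; rewrite normrM ler_wpM2l //.
rewrite ger0_norm ?divr_ge0 ?exprn_ge0 ?ler0n // ler_pdivrMr ?exprn_gt0 //.
rewrite ler_pdivlMl // -exprS; apply: ler_weXn2l => //; exact: ltn_ord.
Qed.

Variables (K : fieldType) (n : nat).
Implicit Types (J : set {mpoly K[n]}).

Lemma quot_degree_ev J k c : quot_krull_dim J = k.+1 ->
  ev_poly (hilbert_function J) k c -> quot_degree J = c.
Proof.
move=> dimJ /ev_poly_cvg hc; rewrite /quot_degree dimJ /=.
apply: xget_unique => //= c' hc'; apply/le_anti.
by rewrite (cvg_int_le _ hc' hc) ?(cvg_int_le _ hc hc').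
Qed.

(** If the limit that defines the degree of J does not exist, the degree is 0 by
    convention, and the bound still holds as c is nonnegative. So J need not
    have a Hilbert polynomial. *)
Lemma quot_degree_le J k H c : quot_krull_dim J = k.+1 ->
  (forall d, hilbert_function J d <= H d)%N -> ev_poly H k c -> 0 <= c ->
  quot_degree J <= c.
Proof.
move=> dimJ JH /ev_poly_cvg hc c0; rewrite /quot_degree dimJ /=.
case: xgetP => //= c' _ hc'; apply: cvg_int_le hc' hc => d.
by rewrite ler_wpM2l ?ler0n // ler_wpM2r ?invr_ge0 ?exprn_ge0 ?ler0n // ler_nat.
Qed.

End Degree.

(** * The greedy minimum of a product *)

Section Greedy.
Local Open Scope nat_scope.

(** The product reached by the strategy that brings each D i down to 1 before
    touching the next. *)
Fixpoint greedy r : ('I_r -> nat) -> nat -> nat :=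
  match r with
  | 0 => fun _ _ => 1
  | _.+1 => fun D d =>
      if d <= D ord0 - 1 then (D ord0 - d) * \prod_i D (lift ord0 i)
      else greedy (fun i => D (lift ord0 i)) (d - (D ord0 - 1))
  end.

(** Since b is below all D i, spending b more units affects at most two factors:
    either a single factor y drops to y - b >= 1, where y <= (b + 1)(y - b), or
    one factor reaches 1 and the next, which is larger, takes the remainder. *)
Lemma greedy_slack r (D : 'I_r -> nat) e b : (forall i, b < D i) ->
  (forall i j : 'I_r, i <= j -> D i <= D j) ->
  greedy D e <= b.+1 * greedy D (e + b).
Proof.
elim: r D e => [|r IH] D e bD mono //=.
have bD0 := bD ord0.
have monoL (i j : 'I_r) : i <= j -> D (lift ord0 i) <= D (lift ord0 j).
  by move=> ij; apply: mono; rewrite !lift0.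
case: (leqP (e + b)) => eb.
  have -> : e <= D ord0 - 1 by lia.
  by rewrite mulnA leq_mul2r; apply/orP; right; nia.
case: (leqP e) => eD; last first.
  have -> : e + b - (D ord0 - 1) = e - (D ord0 - 1) + b by lia.
  by apply: IH => // i; apply: bD.
case: r {IH} D bD mono monoL bD0 eb eD => [|r] D bD mono monoL bD0 eb eD.
  by rewrite /= big_ord0; lia.
have D01 : D ord0 <= D (lift ord0 ord0) by apply: mono.
have bD1 := bD (lift ord0 ord0).
rewrite /= big_ord_recl ifT; last by lia.
rewrite !mulnA leq_mul2r; apply/orP; right.
set x := D ord0 in bD0 D01 eb eD *; set y := D (lift ord0 ord0) in D01 bD1 *.
(* f is what is left for the second factor once the first has reached 1. *)
have [f ef] : exists f, e + b = x - 1 + f by exists (e + b - (x - 1)); lia.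
have -> : e + b - (x - 1) = f by lia.
have -> : x - e = b.+1 - f by lia.
rewrite mulnBl mulnBr; have : f * b.+1 <= f * y by rewrite leq_mul2l bD1 orbT.
lia.
Qed.

(** Lowering the first number by less than the greedy amount leaves more units
    for the later ones; that these cannot make up for it is the slack estimate
    if the first number would have been exhausted, and otherwise the inequality
    x (y - u) >= (x - u) y for x <= y. *)
Lemma greedy_min r (D x : 'I_r -> nat) d :
  (forall i j : 'I_r, i <= j -> D i <= D j) ->
  (forall i, 0 < x i <= D i) -> \sum_i D i <= \sum_i x i + d ->
  greedy D d <= \prod_i x i.
Proof.
elim: r D x d => [|r IH] D x d mono xD; first by rewrite !big_ord0.
have /andP[x0 xD0] := xD ord0.
have monoL (i j : 'I_r) : i <= j -> D (lift ord0 i) <= D (lift ord0 j).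
  by move=> ij; apply: mono; rewrite !lift0.
have mono0 (i : 'I_r) : D ord0 <= D (lift ord0 i) by apply: mono.
rewrite !big_ord_recl => sums.
have sumxD : \sum_(i < r) x (lift ord0 i) <= \sum_(i < r) D (lift ord0 i).
  by apply: leq_sum => i _; have /andP[] := xD (lift ord0 i).
have := IH (fun i => D (lift ord0 i)) (fun i => x (lift ord0 i))
  (d - (D ord0 - x ord0)) monoL (fun i => xD (lift ord0 i)).
have sumsL : \sum_(i < r) D (lift ord0 i) <=
    \sum_(i < r) x (lift ord0 i) + (d - (D ord0 - x ord0)) by lia.
move=> /(_ sumsL) {IH sumsL}; set P := \prod_(i < r) x (lift ord0 i).
rewrite -(leq_pmul2l x0); apply: leq_trans.
rewrite /=; case: (leqP d (D ord0 - 1)) => dD; last first.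
  have -> : d - (D ord0 - x ord0) = d - (D ord0 - 1) + (x ord0 - 1) by lia.
  rewrite -{1}(subnK x0) addn1.
  by apply: greedy_slack => // i; have := mono0 i; lia.
case: r D x mono xD x0 xD0 monoL mono0 sums sumxD @P dD =>
  [|r] D x mono xD x0 xD0 monoL mono0 sums sumxD P dD.
  by rewrite !big_ord0 in sums *; rewrite /=; lia.
have D01 := mono0 ord0.
rewrite /= big_ord_recl ifT; last by lia.
rewrite !mulnA leq_mul2r; apply/orP; right.
set y := D (lift ord0 ord0) in D01 *.
have [u eu] : exists u, d = D ord0 - x ord0 + u.
  by exists (d - (D ord0 - x ord0)); lia.
have -> : d - (D ord0 - x ord0) = u by lia.
have -> : D ord0 - d = x ord0 - u by lia.
rewrite mulnBl mulnBr; have : x ord0 * u <= y * u by rewrite leq_mul2r; lia.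
lia.
Qed.

Definition decomposition r (D : 'I_r -> nat) d (k : 'I_r) l :=
  d = \sum_(i < r | i < k) (D i - 1) + l /\ 1 <= l <= D k - 1.

Lemma greedy_decomposition r (D : 'I_r -> nat) d k l : decomposition D d k l ->
  greedy D d = (D k - l) * \prod_(i < r | k < i) D i.
Proof.
elim: r D d k => [|r IH] D d k; first by case: k.
move=> [ed /andP[l1 lD]]; case: (unliftP ord0 k) ed lD => [k'|] -> ed lD.
  rewrite big_mkcond big_ord_recl -big_mkcond /= in ed.
  have {}ed : d = D ord0 - 1 + \sum_(i < r | i < k') (D (lift ord0 i) - 1) + l := ed.
  rewrite /= ifF; last by lia.
  rewrite (IH _ _ k'); last by split; rewrite ?l1 // ed -addnA addKn.
  by congr (_ * _); rewrite [RHS]big_mkcond big_ord_recl -big_mkcond /= mul1n.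
rewrite big_pred0_eq in ed; rewrite /= ed add0n lD; congr (_ * _).
by rewrite [RHS]big_mkcond big_ord_recl /= mul1n.
Qed.

Lemma exists_decomposition r (D : 'I_r -> nat) d : 0 < d ->
  d < \sum_(i < r) (D i - 1) -> exists k l, decomposition D d k l.
Proof.
elim: r D d => [|r IH] D d d0; first by rewrite big_ord0.
rewrite big_ord_recl => dsum; case: (leqP d (D ord0 - 1)) => dD.
  exists ord0, d; split; last by rewrite d0.
  by rewrite big_pred0_eq.
have [||k [l [ed lD]]] := IH (fun i => D (lift ord0 i)) (d - (D ord0 - 1)).
- by lia.
- by lia.
exists (lift ord0 k), l; split=> //.
by rewrite big_mkcond big_ord_recl -big_mkcond /= -addnA -ed; lia.
Qed.

Definition greedy_choice r (D : 'I_r -> nat) (k : 'I_r) l (i : 'I_r) : nat :=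
  if i < k then D i - 1 else if i == k then l else 0.

Lemma greedy_choice_sum r (D : 'I_r -> nat) d k l : decomposition D d k l ->
  \sum_i greedy_choice D k l i = d.
Proof.
move=> [-> _]; rewrite (bigID (fun i : 'I_r => i < k)) /=; congr (_ + _).
  by apply: eq_bigr => i ik; rewrite /greedy_choice ik.
rewrite (bigD1 k) ?ltnn //= big1 ?addn0; first by rewrite /greedy_choice ltnn eqxx.
by move=> i /andP[/negbTE ik /negbTE neq]; rewrite /greedy_choice ik neq.
Qed.

Lemma greedy_choice_prod r (D : 'I_r -> nat) k l : (forall i, 0 < D i) ->
  \prod_i (D i - greedy_choice D k l i) = (D k - l) * \prod_(i < r | k < i) D i.
Proof.
move=> D0; rewrite (bigID (fun i : 'I_r => i < k)) /= big1 ?mul1n; last first.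
  by move=> i ik; rewrite /greedy_choice ik; have := D0 i; lia.
rewrite (bigD1 k) ?ltnn //= {1}/greedy_choice ltnn eqxx; congr (_ * _).
apply: eq_big => [i|i /andP[/negbTE ik /negbTE neq]].
  by rewrite -leqNgt andbC eq_sym -val_eqE /= ltn_neqAle.
by rewrite /greedy_choice ik neq subn0.
Qed.

Lemma greedy_choice_lt r (D : 'I_r -> nat) d k l i : (forall i, 0 < D i) ->
  decomposition D d k l -> greedy_choice D k l i < D i.
Proof.
move=> D0 [_ /andP[l1 lD]]; rewrite /greedy_choice.
by have := D0 i; case: ifP => // _; [lia|case: eqP => [->|]; lia].
Qed.

End Greedy.

(** * Degrees of I, (I, t^a) and (I, f) *)

Section Degrees.
Variables (K : fieldType) (n r : nat) (alpha : 'I_r -> 'X_{1..n.+1}).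
Hypothesis disj : disjoint_supports alpha.
Hypothesis rn : (r <= n)%N.
Local Notation S := {mpoly K[n.+1]}.
Local Notation I := (@monI K n.+1 r alpha).
Local Notation D i := (mdeg (alpha i)).
Implicit Types (f : S) (a m : 'X_{1..n.+1}).

Lemma ev_poly_disjoint (beta : 'I_r -> 'X_{1..n.+1}) : disjoint_supports beta ->
  ev_poly (fun e => size (std_monomials (divisible beta) e)) (n - r)
    (\prod_i (mdeg (beta i))%:Z).
Proof.
move=> disjb; pose gs := [seq beta i | i <- enum 'I_r].
have -> : (fun e => size (std_monomials (divisible beta) e)) = std_count gs.
  apply/funext => e; congr size; apply: eq_filter => m; congr (~~ _).
  apply/existsP/hasP => [[i im]|[_ /mapP[i _ ->] im]]; last by exists i.
  by exists (beta i) => //; apply/map_f; rewrite mem_enum.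
have -> : \prod_i (mdeg (beta i))%:Z = \prod_(g <- gs) (mdeg g)%:Z.
  by rewrite big_map /index_enum -enumT.
have szgs : size gs = r by rewrite size_map size_enum_ord.
rewrite -szgs; apply: ev_poly_std_count; last by rewrite szgs.
rewrite pairwise_map; have := enum_uniq 'I_r; rewrite uniq_pairwise.
apply: sub_pairwise => i j /= ij; apply/forallP => v; apply: contraNT ij.
by rewrite negb_or => /andP[iv jv]; apply/eqP; apply: disjb iv jv.
Qed.

Lemma ev_poly_add_monomial a :
  ev_poly (fun e => size (std_monomials (fun m => divisible alpha m || (a <= m)%MM) e))
    (n - r) (\prod_i (D i)%:Z - \prod_i (mdeg (alpha i - a)%MM)%:Z).
Proof.
have disjb : disjoint_supports (fun i => alpha i - a)%MM.
  move=> i j v; rewrite !mnmBE => iv jv; apply: (disj (v := v)).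
    by apply: contra iv => /eqP ->.
  by apply: contra jv => /eqP ->.
apply: (@ev_poly_sub _ _ _ _ _ _ (mdeg a) (ev_poly_disjoint disj) (ev_poly_disjoint disjb)) => e ae.
pose gs := [seq alpha i | i <- enum 'I_r].
have divE (beta : 'I_r -> 'X_{1..n.+1}) m :
    divisible beta m = div_by [seq beta i | i <- enum 'I_r] m.
  apply/existsP/hasP => [[i im]|[_ /mapP[i _ ->] im]]; last by exists i.
  by exists (beta i) => //; apply/map_f; rewrite mem_enum.
rewrite (_ : size (std_monomials (divisible alpha) e) = std_count gs e); last first.
  by congr size; apply: eq_filter => m; rewrite divE.
rewrite -(std_count_cons gs ae); congr addn; congr size; apply: eq_filter => m.
  by rewrite divE orbC.
by rewrite divE /gs -map_comp.
Qed.

(** Outside I, such monomials are exactly the zero divisors modulo I. *)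
Definition meets a : Prop := exists i v, alpha i v != 0%N /\ a v != 0%N.

Definition add_gen f : set S := ideal_gen (I `|` [set f]).

Lemma add_gen_ideal f : is_ideal (add_gen f).
Proof. exact: ideal_gen_ideal. Qed.

Lemma monI_sub_add_gen f : I `<=` add_gen f.
Proof. by move=> g Ig; apply: sub_ideal_gen; left. Qed.

Lemma add_gen_mem f : add_gen f f.
Proof. by apply: sub_ideal_gen; right. Qed.

Lemma add_gen_monomial a :
  add_gen 'X_[a] = mon_ideal (fun m => divisible alpha m || (a <= m)%MM).
Proof.
have upA : up_closed (fun m => divisible alpha m || (a <= m)%MM).
  move=> m m' /orP[im|am] mm'; first by rewrite (divisible_up im mm').
  by rewrite (lepm_trans am mm') orbT.
apply/seteqP; split.
  apply: ideal_gen_sub; first exact: mon_ideal_ideal.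
  move=> f [If m /If -> //|-> m]; rewrite msuppX inE => /eqP ->.
  by rewrite lepm_refl orbT.
move=> f; apply: mon_ideal_span; first exact: add_gen_ideal.
move=> m /orP[im|am]; first by apply: monI_sub_add_gen; apply/mon_idealX.
rewrite -(submK am) mpolyXD; apply: idealM; first exact: add_gen_ideal.
exact: add_gen_mem.
Qed.

Hypothesis nz : forall i, alpha i != 0%MM.

Lemma meets_transversal a : meets a ->
  exists2 t, transversal_vars alpha t & weight (vars t) a != 0%N.
Proof.
move=> [i [v [iv av]]]; have [t0 ht0] := exists_transversal nz.
exists (fun j => if j == i then v else t0 j).
  by move=> j; have [->|_] := eqVneq j i; last exact: ht0.
apply/weight_neq0P; exists v => //; apply/imsetP; exists i => //.
by rewrite eqxx.
Qed.

Lemma transversal_meets t a : transversal_vars alpha t ->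
  weight (vars t) a != 0%N -> meets a.
Proof.
move=> ht /weight_neq0P[_ /imsetP[i _ ->] ai]; exists i, (t i); split=> //.
Qed.

Lemma dim_monI : quot_krull_dim I = (n - r).+1.
Proof.
have [t ht] := exists_transversal nz.
rewrite (@quot_krull_dim_monI _ _ _ _ _ t disj ht) ?subSn //.
exact: monI_sub_var_ideal.
Qed.

(** The ideal lies between I and a prime generated by r variables. *)
Lemma dim_add_gen f t : transversal_vars alpha t -> var_ideal (vars t) f ->
  quot_krull_dim (add_gen f) = (n - r).+1.
Proof.
move=> ht tf; rewrite (@quot_krull_dim_monI _ _ _ _ _ t disj ht) ?subSn //.
  exact: monI_sub_add_gen.
apply: ideal_gen_sub; first exact: var_ideal_ideal.
by move=> g [|->//]; apply: monI_sub_var_ideal.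
Qed.

Lemma degree_monI : quot_degree I = \prod_i (D i)%:Z.
Proof.
apply: quot_degree_ev dim_monI _.
rewrite (_ : hilbert_function _ = fun e => size (std_monomials (divisible alpha) e)).
  exact: ev_poly_disjoint.
by apply/funext => e; rewrite hilbert_mon_ideal //; apply: divisible_up.
Qed.

Lemma degree_add_monomial a : meets a ->
  quot_degree (add_gen 'X_[a]) =
    \prod_i (D i)%:Z - \prod_i (mdeg (alpha i - a)%MM)%:Z.
Proof.
move=> /meets_transversal[t ht ta].
have dimJ : quot_krull_dim (add_gen 'X_[a]) = (n - r).+1.
  by apply: dim_add_gen ht _; apply/mon_idealX.
apply: quot_degree_ev dimJ _.
rewrite add_gen_monomial (_ : hilbert_function _ = fun e => size (std_monomials
  (fun m => divisible alpha m || (a <= m)%MM) e)); first exact: ev_poly_add_monomial.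
apply/funext => e; rewrite hilbert_mon_ideal //.
move=> m m' /orP[im|am] mm'; first by rewrite (divisible_up im mm').
by rewrite (lepm_trans am mm') orbT.
Qed.

Lemma colon_monomial a : ~~ divisible alpha a ->
  colon I 'X_[a] <> I <-> meets a.
Proof.
move=> na; split; last first.
  by move=> /meets_transversal[t ht ta]; apply: var_ideal_zero_divisor ta.
by move=> /zero_divisor_var_ideal[t ht /mon_idealX ta]; apply: transversal_meets ta.
Qed.

(** All monomials of the zero divisor f lie in one prime generated by variables,
    so the leading monomial a of the part f' of f outside I is again a zero
    divisor. Standard monomials for (I, t^a) span S/(I, f), and both ideals have
    the same dimension. *)
Lemma degree_add_le (le : rel 'X_{1..n.+1}) f d : graded_monomial_order le ->
  zero_divisors_in_degree I d f ->
  exists a, [/\ mdeg a = d, ~~ divisible alpha a, meets a &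
    quot_degree (add_gen f) <= quot_degree (add_gen 'X_[a])].
Proof.
move=> order_le [hf [nIf /zero_divisor_var_ideal[t ht tf]]].
(* The normal form of f modulo I. *)
pose f' := \sum_(m <- msupp f | ~~ divisible alpha m) f@_m *: 'X_[m].
have f'm m : f'@_m = if divisible alpha m then 0 else f@_m.
  rewrite raddf_sum /=; under eq_bigr do rewrite mcoeffZ mcoeffX.
  rewrite big_mkcond; have [mf|mf] := boolP (m \in msupp f); last first.
    rewrite (memN_msupp_eq0 mf) if_same big_seq big1 // => m' m'f; case: ifP => // _.
    by have /negbTE -> : m' != m; [apply: contraNneq mf => <-|rewrite mulr0].
  rewrite (bigD1_seq m) //= eqxx mulr1 big1 ?addr0; first by case: (divisible alpha m).
  by move=> m' /negbTE ->; rewrite mulr0 if_same.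
have f'supp m : (m \in msupp f') = ~~ divisible alpha m && (m \in msupp f).
  by rewrite !mcoeff_msupp f'm; case: ifP => //; rewrite eqxx.
have Iff' : I (f - f').
  move=> m; rewrite mcoeff_msupp mcoeffB f'm; case: ifP => //.
  by rewrite subrr eqxx.
have [[refl_le anti_le tr_le tot_le] _] := order_le.
have [|a af' maxa] := @seq_has_max _ le (msupp f') tot_le tr_le.
  rewrite msupp_eq0; apply/eqP => f'0; apply: nIf.
  by move: Iff'; rewrite f'0 subr0.
have := af'; rewrite f'supp => /andP[na af].
have ta : weight (vars t) a != 0%N by apply: tf.
have meets_a : meets a by apply: transversal_meets ht ta.
exists a; split=> //; first exact: (dhomogP _ _ _ hf).
have hf' : homog_part d f'.
  by apply/dhomogP => m; rewrite f'supp => /andP[_ /(dhomogP _ _ _ hf)].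
have Jf' : add_gen f f'.
  rewrite -[f'](subKr f); apply: idealB; first exact: add_gen_ideal.
    exact: add_gen_mem.
  exact: monI_sub_add_gen.
rewrite degree_add_monomial //.
apply: quot_degree_le (dim_add_gen ht tf) _ (ev_poly_add_monomial a) _.
  move=> e; apply: hilbert_function_le; first exact: add_gen_ideal.
  apply: homog_reduce order_le _ _ Jf' hf' _ => //.
    exact: add_gen_ideal.
  exact: monI_sub_add_gen.
rewrite subr_ge0; apply: ler_prod => i _; apply/andP; split=> //.
by rewrite lez_nat mdegB.
Qed.

End Degrees.

(** * The minimum distance and the footprint *)

Lemma Posz_prod (T : finType) (P : pred T) (F : T -> nat) :
  (\prod_(i | P i) F i)%N%:Z = \prod_(i | P i) (F i)%:Z.
Proof. exact: (big_morph Posz PoszM erefl). Qed.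

Section Distances.
Variables (K : fieldType) (n r : nat) (alpha : 'I_r -> 'X_{1..n.+1}).
Variables (le : rel 'X_{1..n.+1}) (d : nat).
Hypothesis order_le : graded_monomial_order le.
Hypothesis disj : disjoint_supports alpha.
Hypothesis rn : (r <= n)%N.
Hypothesis nz : forall i, alpha i != 0%MM.
Local Notation I := (@monI K n.+1 r alpha).
Local Notation D := (fun i => mdeg (alpha i)).
Implicit Types (a b m : 'X_{1..n.+1}).

(** The monomials over which the footprint is minimised. *)
Definition candidate a : Prop := [/\ mdeg a = d, ~~ divisible alpha a & meets alpha a].

(** The degree of the complete intersection (I : t^a). *)
Definition colon_degree a : nat := (\prod_i mdeg (alpha i - a)%MM)%N.

Lemma initial_monI : initial_ideal le I = I.
Proof.
apply: initial_mon_ideal; first by have [[]] := order_le.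
exact: divisible_up.
Qed.

Lemma footprint_monomialsP a : footprint_monomials le I d a <-> candidate a.
Proof.
rewrite /footprint_monomials initial_monI /=; split.
  move=> [da [/mon_idealX/negP na /colon_monomial ca]]; split=> //; exact: ca.
move=> [da na ca]; split=> //; split; first by move/mon_idealX; apply/negP.
exact/colon_monomial.
Qed.

Lemma degree_add_candidate a : candidate a ->
  quot_degree (ideal_gen (I `|` [set 'X_[a]])) = quot_degree I - (colon_degree a)%:Z.
Proof.
move=> [_ _ ca]; rewrite [LHS](degree_add_monomial K disj rn nz ca).
by rewrite (degree_monI K disj rn nz) /colon_degree Posz_prod.
Qed.

Lemma distances_no_candidate : (forall a, ~ candidate a) ->
  min_distance I d = quot_degree I /\ footprint le I d = quot_degree I.
Proof.
move=> noc; rewrite /min_distance /footprint; split; rewrite ifT //; apply/eqP.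
  rewrite -subset0 => f /(degree_add_le disj rn nz order_le)[a [da na ca _]].
  exact: (noc a).
by rewrite -subset0 => a /footprint_monomialsP /noc.
Qed.

(** The footprint is the minimum over candidates by definition; the minimum
    distance is bounded below by it through leading monomials, and candidates
    are themselves zero divisors of degree d. *)
Lemma distances_candidate a : candidate a ->
  (forall b, candidate b -> (colon_degree a <= colon_degree b)%N) ->
  min_distance I d = (colon_degree a)%:Z /\ footprint le I d = (colon_degree a)%:Z.
Proof.
move=> ca mina.
have Ma : footprint_monomials le I d a by apply/footprint_monomialsP.
have Fa : zero_divisors_in_degree I d 'X_[a].
  move: Ma; rewrite /footprint_monomials initial_monI => -[da [na ma]].
  by split=> //; rewrite /homog_part /= dhomogX; apply/eqP.
have bound b : candidate b -> quot_degree (ideal_gen (I `|` [set 'X_[b]])) <=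
    quot_degree I - (colon_degree a)%:Z.
  by move=> cb; rewrite degree_add_candidate // lerD2l lerN2 lez_nat; apply: mina.
split.
  rewrite /min_distance ifF; last by apply/eqP => F0; rewrite F0 in Fa.
  rewrite (@set_max_eq _ _ _ (quot_degree I - (colon_degree a)%:Z)) ?subKr //.
    by exists 'X_[a] => //; apply: degree_add_candidate.
  move=> _ [f /(degree_add_le disj rn nz order_le)[b [db nb cb fb]] <-].
  by apply: le_trans fb _; apply: bound.
rewrite /footprint ifF; last by apply/eqP => F0; rewrite F0 in Ma.
rewrite initial_monI (@set_max_eq _ _ _ (quot_degree I - (colon_degree a)%:Z)) ?subKr //.
  by exists a => //; apply: degree_add_candidate.
by move=> _ [b /footprint_monomialsP cb <-]; apply: bound.
Qed.

Lemma colon_gt0 a i : ~~ divisible alpha a -> (0 < mdeg (alpha i - a)%MM)%N.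
Proof.
move=> na; rewrite lt0n mdeg_eq0; apply: contra na => /eqP/mnmP ia.
apply/existsP; exists i; apply/mnm_lepP => v.
by have := ia v; rewrite mnmBE mnm0E => /eqP; rewrite subn_eq0.
Qed.

Lemma sum_disjoint v (F : 'I_r -> nat -> nat) i : (forall j, F j 0%N = 0%N) ->
  alpha i v != 0%N -> (\sum_j F j (alpha j v) = F i (alpha i v))%N.
Proof.
move=> F0 iv; rewrite (bigD1 i) //= big1 ?addn0 // => j ij.
have [->|jv] := eqVneq (alpha j v) 0%N; first exact: F0.
by case/eqP: ij; apply: disj jv iv.
Qed.

(** At each variable at most one alpha i is nonzero, so dividing by t^a lowers
    the exponents there by at most a v in total. *)
Lemma sum_degrees_le a :
  (\sum_i D i <= \sum_i mdeg (alpha i - a)%MM + mdeg a)%N.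
Proof.
under eq_bigr do rewrite mdegE.
under [X in (_ <= X + _)%N]eq_bigr do rewrite mdegE.
rewrite exchange_big [X in (_ <= X + _)%N]exchange_big mdegE -big_split /=.
apply: leq_sum => v _.
have [/existsP[i iv]|/existsPn none] := boolP [exists i, alpha i v != 0%N].
  rewrite (@sum_disjoint v (fun _ k => k) i) //.
  under eq_bigr do rewrite mnmBE.
  rewrite (@sum_disjoint v (fun _ k => k - a v)%N i) //.
  by rewrite addnC -leq_subLR.
by rewrite big1 // => i _; apply/eqP; rewrite -[_ == _]negbK.
Qed.

Lemma greedy_le_colon_degree a :
  (forall i j : 'I_r, (i <= j)%N -> (D i <= D j)%N) -> candidate a ->
  (greedy D d <= colon_degree a)%N.
Proof.
move=> mono [da na _]; apply: greedy_min => //.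
  by move=> i; rewrite colon_gt0 // mdegB.
by rewrite -da; apply: sum_degrees_le.
Qed.

Lemma submonomial m c : (c <= mdeg m)%N -> exists b, (b <= m)%MM /\ mdeg b = c.
Proof.
elim: c => [|c IH] cm; first by exists 0%MM; split; [apply/mnm_lepP => v; rewrite mnm0E|rewrite mdeg0].
have [b [bm bc]] := IH (ltnW cm).
have [v bv] : exists v, (b v < m v)%N.
  apply: contrapT => H; move: cm; rewrite -bc ltnNge => /negP; apply.
  rewrite !mdegE; apply: leq_sum => v _; rewrite leqNgt; apply/negP => bv.
  by apply: H; exists v.
exists (b + U_(v))%MM; rewrite mdegD mdeg1 bc addn1; split=> //.
apply/mnm_lepP => w; rewrite mnmDE mnm1E; case: eqVneq => [<-|_]; first by rewrite addn1.
by rewrite addn0; apply: (mnm_lepP bm).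
Qed.

(** Since supports are disjoint, the choices b i do not interfere. The extra
    power of the variable x is harmless if b i already has the full exponent of
    alpha i at x. *)
Lemma sum_submonomials (b : 'I_r -> 'X_{1..n.+1}) x e i :
  (forall i, (b i <= alpha i)%MM) ->
  (e = 0%N \/ forall i, (alpha i x <= b i x)%N) ->
  (alpha i - (\sum_i b i + U_(x) *+ e) = alpha i - b i)%MM.
Proof.
move=> ba ex; apply/mnmP => v; rewrite !mnmBE mnmDE mulmnE mnm1E mnm_sumE.
have [->|iv] := eqVneq (alpha i v) 0%N; first by rewrite !sub0n.
rewrite (bigD1 i) //= big1 => [|j ij]; last first.
  apply/eqP; rewrite -leqn0; apply: leq_trans (mnm_lepP (ba j) v) _.
  by rewrite leqn0; apply: contraNT ij => jv; apply/eqP/(disj jv iv).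
rewrite addn0; case: ex => [->|xb]; first by rewrite muln0 addn0.
have [<-|_] := eqVneq x v; last by rewrite mul0n addn0.
by have := xb i; lia.
Qed.

Lemma candidate_of_submonomials (b : 'I_r -> 'X_{1..n.+1}) x e :
  (forall i, (b i <= alpha i)%MM) -> (forall i, mdeg (b i) < D i)%N ->
  (e = 0%N \/ forall i, (alpha i x <= b i x)%N) ->
  (0 < \sum_i mdeg (b i))%N -> d = (\sum_i mdeg (b i) + e)%N ->
  candidate (\sum_i b i + U_(x) *+ e)%MM /\
  colon_degree (\sum_i b i + U_(x) *+ e)%MM = (\prod_i (D i - mdeg (b i)))%N.
Proof.
move=> ba bD ex b0 de; set a := (_ + _)%MM.
have sub i : (alpha i - a = alpha i - b i)%MM by apply: sum_submonomials.
have deg_sub i : mdeg (alpha i - b i)%MM = (D i - mdeg (b i))%N.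
  by rewrite -{2}(submK (ba i)) mdegD addnK.
split; last by apply: eq_bigr => i _; rewrite sub deg_sub.
split.
- by rewrite /a mdegD mdegMn mdeg1 mul1n mdeg_sum.
- apply/existsPn => i; apply/negP => /mnm_lepP ia.
  have : mdeg (alpha i - a)%MM = 0%N.
    apply/eqP; rewrite mdeg_eq0; apply/eqP/mnmP => v; rewrite mnmBE mnm0E.
    by apply/eqP; rewrite subn_eq0.
  by rewrite sub deg_sub; have := bD i; lia.
have [i bi] : exists i, mdeg (b i) != 0%N.
  apply/existsP; rewrite -[[exists _, _]]negbK negb_exists.
  apply: contraTN b0 => /forallP H; rewrite -leqNgt leqn0 sum_nat_eq0.
  by apply/forallP => i; apply/implyP => _; rewrite -[_ == _]negbK.
have [v bv] : exists v, b i v != 0%N.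
  apply/existsP; rewrite -[[exists _, _]]negbK negb_exists.
  apply: contra bi => /forallP H; rewrite mdegE sum_nat_eq0.
  by apply/forallP => v; apply/implyP => _; rewrite -[_ == _]negbK.
exists i, v; split.
  by rewrite -lt0n (leq_trans _ (mnm_lepP (ba i) v)) // lt0n.
by rewrite /a mnmDE mnm_sumE (bigD1 i) //= -addnA addn_eq0 negb_and bv.
Qed.

(** When d is small the greedy amounts add up to exactly d, and the product of
    the corresponding submonomials has degree d. *)
Lemma distances_small k l :
  (forall i j : 'I_r, (i <= j)%N -> (D i <= D j)%N) ->
  (0 < d)%N -> decomposition D d k l ->
  min_distance I d = (greedy D d)%:Z /\ footprint le I d = (greedy D d)%:Z.
Proof.
move=> mono d0 dec.
have D0 i : (0 < D i)%N by rewrite lt0n mdeg_eq0.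
have /choice[b hb] i : exists b, (b <= alpha i)%MM /\ mdeg b = greedy_choice D k l i.
  exact/submonomial/ltnW/(greedy_choice_lt i D0 dec).
have degb : (\sum_i mdeg (b i) = d)%N.
  by rewrite -(greedy_choice_sum dec); apply: eq_bigr => i _; have [] := hb i.
have [|||||ca va] := @candidate_of_submonomials b ord0 0.
- by move=> i; have [] := hb i.
- by move=> i; have [_ ->] := hb i; apply: greedy_choice_lt dec.
- by left.
- by rewrite degb.
- by rewrite degb addn0.
have eg : colon_degree (\sum_i b i + U_(ord0) *+ 0)%MM = greedy D d.
  rewrite va (greedy_decomposition dec) -(greedy_choice_prod k l D0).
  by apply: eq_bigr => i _; have [_ ->] := hb i.
rewrite -eg; apply: distances_candidate => // b' cb'.
by rewrite eg; apply: greedy_le_colon_degree.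
Qed.

(** When d is large, lower every alpha i by all but one variable t i, and reach
    degree d with a variable x different from all t i, which exists because r <=
    n. If every generator is a variable there is no candidate: I is prime, and
    of degree 1. *)
Lemma distances_large : (\sum_i (D i - 1) <= d)%N ->
  min_distance I d = 1 /\ footprint le I d = 1.
Proof.
move=> sumd; have D0 i : (0 < D i)%N by rewrite lt0n mdeg_eq0.
have [sum0|sum_neq0] := eqVneq (\sum_i (D i - 1))%N 0%N.
  have D1 i : D i = 1%N.
    move/eqP: sum0; rewrite sum_nat_eq0 => /forallP/(_ i) /= /eqP.
    by have := D0 i; lia.
  have -> : 1 = quot_degree I.
    by rewrite (degree_monI K disj rn nz) big1 // => i _; rewrite D1.
  apply: distances_no_candidate => a [_ /negP na [i [v [iv av]]]]; apply: na.
  apply/existsP; exists i; have /eqP/mdeg1P[w /eqP ew] := D1 i.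
  by move: iv; rewrite ew mnm1E lep1mP eqb0 negbK => /eqP ->.
have [t ht] := exists_transversal nz.
have [x xt] : exists x, x \notin vars t.
  apply/existsP; rewrite -[[exists _, _]]negbK negb_exists.
  apply/negP => /forallP H; have := vars_card disj ht.
  have -> : vars t = [set: 'I_n.+1]%SET.
    by apply/setP => x; rewrite inE; apply/negPn/H.
  by rewrite cardsT card_ord => nr; move: rn; rewrite -nr ltnn.
pose b i := (alpha i - U_(t i))%MM.
have Ut i : (U_(t i) <= alpha i)%MM by rewrite lep1mP ht.
have degb i : mdeg (b i) = (D i - 1)%N.
  by rewrite -(submK (Ut i)) mdegD mdeg1 addnK.
have sumb : (\sum_i mdeg (b i) = \sum_i (D i - 1))%N by apply: eq_bigr.
pose e := (d - \sum_i (D i - 1))%N.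
have [|||||ca va] := @candidate_of_submonomials b x e.
- by move=> i; apply: lem_subr.
- by move=> i; rewrite degb; have := D0 i; lia.
- right=> i; rewrite mnmBE mnm1E; case: eqVneq => [tx|_]; last by rewrite subn0.
  by case/negP: xt; rewrite -tx; apply: imset_f.
- by rewrite sumb lt0n.
- by rewrite sumb subnKC.
have e1 : colon_degree (\sum_i b i + U_(x) *+ e)%MM = 1%N.
  by rewrite va big1 // => i _; rewrite degb; have := D0 i; lia.
rewrite -[1]/(1%N%:Z) -e1; apply: distances_candidate => // b' [_ nb' _].
by rewrite e1; apply: prodn_gt0 => i; apply: colon_gt0.
Qed.

End Distances.

Theorem theorem5p5 (K : fieldType) (s : nat) (le : rel 'X_{1..s})
    (I : set {mpoly K[s]}) (r : nat) (alpha : 'I_r -> 'X_{1..s}) (d : nat)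
    (le_order : graded_monomial_order le)
    (I_gens : minimal_generators (fun i => 'X_[K, alpha i]) I)
    (I_neq0 : exists2 f, I f & f != 0)
    (I_ci : complete_intersection I)
    (I_dim : (1 <= quot_krull_dim I)%N)
    (alpha_sorted : forall i j : 'I_r, (i <= j)%N ->
       (mdeg (alpha i) <= mdeg (alpha j))%N)
    (d_gt0 : (1 <= d)%N) :
  let D (i : 'I_r) := mdeg (alpha i) in
  let decomposition (k : 'I_r) (l : nat) :=
    d = (\sum_(i < r | (i < k)%N) (D i - 1) + l)%N /\ (1 <= l <= D k - 1)%N in
  min_distance I d = footprint le I d /\
  ((d < \sum_(i < r) (D i - 1))%N ->
     (exists k l, decomposition k l) /\
     forall k l, decomposition k l ->
       footprint le I d =
         ((D k)%:Z - l%:Z) * \prod_(i < r | (k < i)%N) (D i)%:Z) /\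
  ((\sum_(i < r) (D i - 1) <= d)%N -> footprint le I d = 1).
Proof.
move=> D dec.
have eI : I = @monI K _ _ alpha by have [-> _] := I_gens; apply: ideal_gen_range_monI.
rewrite eI in I_gens I_ci I_dim *; move=> {I I_neq0 eI}.
have nz i : alpha i != 0%MM.
  apply/eqP => i0; move: I_dim; rewrite /quot_krull_dim /set_max.
  case: xgetP => // k _ [[Q [[Qprime _] IQ]] _] _.
  have /prime_idealP[_ + _] := Qprime 0%N isT; apply; apply: IQ.
  by rewrite -mpolyX0 -i0; apply: monI_gen.
have disj := complete_intersection_disjoint nz I_gens I_ci.
have [t ht] := exists_transversal nz.
have dimI : quot_krull_dim (@monI K _ _ alpha) = (s - r)%N.
  by rewrite (quot_krull_dim_monI disj ht) //; apply: monI_sub_var_ideal.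
rewrite dimI in I_dim; case: s => [|n] in le alpha le_order I_gens I_ci alpha_sorted D dec nz disj t ht dimI I_dim *.
  by [].
have rn : (r <= n)%N by lia.
have [small|large] := ltnP d (\sum_i (D i - 1))%N; last first.
  have [-> ->] := distances_large K le_order disj rn nz large.
  by split=> //; split=> // lt; move: (leq_trans lt large); rewrite ltnn.
have [k [l dkl]] := exists_decomposition d_gt0 small.
have [-> ->] := distances_small K le_order disj rn nz alpha_sorted d_gt0 dkl.
split=> //; split=> [_|//].
split; first by exists k, l.
move=> k' l' dkl'; rewrite (greedy_decomposition dkl') PoszM; congr (_ * _).
  by case: dkl' => _; lia.
by rewrite Posz_prod.
Qed.
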